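(* Let $s$ be a positive integer and let $K_{1,s}$ be the reproducing kernel of the univariate Sobolev space $W^s_2(\mathbb{R})$. Then for all $x,t\in\mathbb{R}$, $$ K_{1,s}(x,t)=-\sum_{j=1}^s\frac{e^{-|x-t|\,\sin(j\pi/(s+1))}}{s+1}\, \sin\left(\frac{j\pi}{s+1}\right)\,\cos\left(|x-t|\,\cos\left(\frac{j\pi}{s+1}\right)+\frac{2j\pi}{s+1}\right). $$
   Context: $W^s_2(\mathbb{R})$ is the Sobolev space of (complex-valued) functions $f\in L_2(\mathbb{R})$ whose weak derivatives $f^{(k)}$, $k=1,\dots,s$, belong to $L_2(\mathbb{R})$, with inner product $\langle f,g\rangle_{W^s_2(\mathbb{R})}=\sum_{k=0}^s\int_{\mathbb{R}}f^{(k)}(x)\overline{g^{(k)}(x)}\,\mathrm{d}x$; elements are identified with their continuous representatives. The reproducing kernel $K_{1,s}$ is the function on $\mathbb{R}\times\mathbb{R}$ with $K_{1,s}(\cdot,t)\in W^s_2(\mathbb{R})$ and $f(t)=\langle f,K_{1,s}(\cdot,t)\rangle_{W^s_2(\mathbb{R})}$ for all $f\in W^s_2(\mathbb{R})$ and $t\in\mathbb{R}$. *)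

(* Defs.v *)
From HB Require Import structures.
From mathcomp Require Import all_boot all_order all_algebra.
From mathcomp Require Import all_classical all_reals all_analysis.
From mathcomp Require Import complex.

Set Implicit Arguments.
Unset Strict Implicit.
Unset Printing Implicit Defensive.

Import Order.TTheory GRing.Theory Num.Theory.
Import numFieldNormedType.Exports.

Local Open Scope classical_set_scope.
Local Open Scope ring_scope.
Local Open Scope complex_scope.

(* R[i] carries neither a canonical topology nor a canonical sigma-algebra
   here, so continuity, measurability, local integrability and integrals of
   complex-valued functions are taken componentwise. *)

Definition ccontinuous (R : realType) (f : R -> R[i]) : Prop :=
  continuous (fun x => complex.Re (f x)) /\
  continuous (fun x => complex.Im (f x)).

Definition cmeasurable (R : realType) (f : R -> R[i]) : Prop :=
  measurable_fun setT (fun x => complex.Re (f x)) /\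
  measurable_fun setT (fun x => complex.Im (f x)).

Definition clocally_integrable (R : realType) (f : R -> R[i]) : Prop :=
  locally_integrable setT (fun x => complex.Re (f x)) /\
  locally_integrable setT (fun x => complex.Im (f x)).

Definition cintegral (R : realType) (f : R -> R[i]) : R[i] :=
  Rintegral lebesgue_measure setT (fun x => complex.Re (f x)) +i*
  Rintegral lebesgue_measure setT (fun x => complex.Im (f x)).

(* Normc.normc is the real-valued modulus. *)
Definition square_integrable (R : realType) (f : R -> R[i]) : Prop :=
  cmeasurable f /\
  (\int[@lebesgue_measure R]_x (Normc.normc (f x) ^+ 2)%:E < +oo)%E.

Definition test_function (R : realType) (phi : R -> R) : Prop :=
  (forall n x, derivable (derive1n n phi) x 1) /\
  compact (closure [set x | phi x != 0]).

(* Testing against real-valued functions is enough, by linearity. *)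
Definition is_weak_derivative (R : realType) (k : nat) (f g : R -> R[i]) :
    Prop :=
  [/\ clocally_integrable f, clocally_integrable g &
      forall phi : R -> R, test_function phi ->
        cintegral (fun x => f x * (derive1n k phi x)%:C) =
        (-1) ^+ k * cintegral (fun x => g x * (phi x)%:C)].

(* A representative of the k-th weak derivative, which is unique up to null
   sets; 0 when f has no k-th weak derivative. *)
Definition weak_derivative (R : realType) (k : nat) (f : R -> R[i]) :
    R -> R[i] :=
  if k is 0%N then f
  else xget (fun=> 0) [set g | is_weak_derivative k f g].

(* Each class in the Sobolev space is represented by its continuous element. *)
Definition sobolev (R : realType) (s : nat) : set (R -> R[i]) :=
  [set f | [/\ ccontinuous f, square_integrable f &
     forall k, (1 <= k <= s)%N ->
       exists2 g, is_weak_derivative k f g & square_integrable g]].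

Definition sobolev_dot (R : realType) (s : nat) (f g : R -> R[i]) : R[i] :=
  \sum_(0 <= k < s.+1)
    cintegral (fun x => weak_derivative k f x * (weak_derivative k g x)^*).

Definition is_reproducing_kernel (R : realType) (s : nat)
    (K : R -> R -> R[i]) : Prop :=
  (forall t, sobolev s (K^~ t)) /\
  (forall f, sobolev s f -> forall t, f t = sobolev_dot s f (K^~ t)).

(* Main.v *)
Require Import Defs.
From HB Require Import structures.
From mathcomp Require Import all_boot all_order all_algebra.
From mathcomp Require Import all_classical all_reals all_analysis.
From mathcomp Require Import complex.
From mathcomp Require Import measurable_realfun zify ring lra.

(** Write G(x, a) for the claimed kernel.  It is enough to know that G(., a) lies
    in the Sobolev space ([kernelC_sobolev]) and that the inner product of G(., a)
    with any u of the space is the conjugate of u(a) ([sobolev_dot_kernel]): the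
    reproducing property of K applied to G(., x) then says that G(t, x) is the
    conjugate of K(x, t), and G is real and depends on the distance only.

    The inner product is computed by moving derivatives from u to G.  To the right
    of a, the k-th derivative of G(., a) at a + y is [profile s k y], a combination
    of the real parts of exp(i y e^(i th)) over th = j pi / (s + 1); to the left
    it is the mirror image, with sign (-1)^k.  Three facts about the profile carry
    the proof.
    - The even derivatives cancel: the sum over k <= s of (-1)^k G^(2k) is 0 away
      from a, because the s + 1 numbers e^(2ik th) add up to 0 ([profile_ode]).
    - The derivatives of order at most 2s - 2 are continuous at a, because the odd
      ones among them vanish at y = 0 ([profile_odd0]).
    - The derivative of order 2s - 1 has jump (-1)^s at a ([kernel_jump]).
    Hence the integral of u^(k) G^(k) is (-1)^k times that of u G^(2k), with an
    additional u(a) when k = s, and the sum over k is u(a) ([green_identity]).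

    Weak derivatives are tested against smooth functions of compact support, and
    G(., a) is neither.  The integration by parts ([by_parts_continuous],
    [by_parts_jump]) therefore goes through test functions that interpolate
    smoothly between the two branches on the short interval from a to
    a + 1/(n + 1) and are cut off far away; dominated convergence removes both
    modifications, and the derivative of the interpolation concentrates at a,
    where it produces the jump term.

    The inner product involves arbitrary representatives of the weak derivatives,
    so their uniqueness up to null sets is needed too ([fundamental_lemma],
    [real_weak_derivative_unique]). *)

Set Implicit Arguments.
Unset Strict Implicit.
Unset Printing Implicit Defensive.

Import Order.TTheory GRing.Theory Num.Theory.
Import numFieldNormedType.Exports.

Local Open Scope classical_set_scope.
Local Open Scope ring_scope.
Local Open Scope complex_scope.

Local Notation mu := lebesgue_measure.
Local Notation intg f := (Rintegral mu setT f).
Local Notation L1 f := (mu.-integrable setT (EFin \o f)).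
Local Notation Re := complex.Re.
Local Notation Im := complex.Im.

(** * Smooth functions *)

Section Smooth.
Context {R : realType}.
Implicit Types f g : R -> R.

Definition smooth f := forall n x, derivable (derive1n n f) x 1.

Lemma derive1_val f (df x : R) : is_derive (x : R) (1 : R) f df -> derive1 f x = df.
Proof. by move=> h; rewrite derive1E (@derive_val _ _ _ _ _ _ _ h). Qed.

Lemma is_derive1_fun f (df : R -> R) :
  (forall x, is_derive (x : R) (1 : R) f (df x)) -> derive1 f = df.
Proof. by move=> h; apply/funext => x; exact: derive1_val. Qed.

(** To prove all derivatives exist at once, it suffices to exhibit a class of
    functions closed under differentiation. *)
Lemma smooth_coind (C : set (R -> R)) :
  (forall f, C f -> exists2 g, C g & forall x, is_derive (x : R) (1 : R) f (g x)) ->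
  forall f, C f -> smooth f.
Proof.
move=> hC f Cf n; elim: n f Cf => [|n IH] f Cf x.
  have [g _ h] := hC f Cf; exact: (@ex_derive _ _ _ _ _ _ _ (h x)).
have [g Cg h] := hC f Cf.
by rewrite derive1Sn (is_derive1_fun h); exact: IH.
Qed.

Lemma smooth_is_derive f x : smooth f -> is_derive (x : R) (1 : R) f (derive1 f x).
Proof. by move=> sf; rewrite derive1E; apply: derivableP; exact: (sf 0%N). Qed.

Lemma smooth_derive1 f : smooth f -> smooth (derive1 f).
Proof. by move=> sf n x; rewrite -derive1Sn; exact: sf. Qed.

Lemma smooth_continuous f : smooth f -> continuous f.
Proof.
by move=> sf x; apply/differentiable_continuous/derivable1_diffP; exact: (sf 0%N).
Qed.

Lemma is_derive1_comp f g (df dg x : R) :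
  is_derive (g x : R) (1 : R) f df -> is_derive (x : R) (1 : R) g dg ->
  is_derive (x : R) (1 : R) (f \o g) (df * dg).
Proof.
move=> hf hg.
have d1 : derivable f (g x) 1 by exact: (@ex_derive _ _ _ _ _ _ _ hf).
have d2 : derivable g x 1 by exact: (@ex_derive _ _ _ _ _ _ _ hg).
apply: DeriveDef.
  apply/derivable1_diffP; apply: differentiable_comp; exact/derivable1_diffP.
by rewrite -derive1E derive1_comp// !derive1E !derive_val.
Qed.

Lemma smooth_cst c : smooth (fun=> c).
Proof.
apply: (@smooth_coind [set f | exists c : R, f = cst c]); last by exists c.
move=> _ [k ->]; exists (cst 0); first by exists 0.
by move=> x; exact: is_derive_cst.
Qed.

(** The class to which [smooth_coind] is applied in order to get the stability of
    smooth functions under the algebraic operations: by the Leibniz and chain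
    rules it is closed under differentiation. *)
Inductive smooth_closure : (R -> R) -> Prop :=
| SCbase f : smooth f -> smooth_closure f
| SCadd f g : smooth_closure f -> smooth_closure g -> smooth_closure (f \+ g)
| SCmul f g : smooth_closure f -> smooth_closure g -> smooth_closure (f \* g)
| SCinv f : (forall x, f x != 0) -> smooth_closure f ->
    smooth_closure (fun x => (f x)^-1)
| SCcomp f g : smooth_closure f -> smooth_closure g -> smooth_closure (f \o g).

Lemma is_derive1D f g (df dg x : R) :
  is_derive (x : R) (1 : R) f df -> is_derive (x : R) (1 : R) g dg ->
  is_derive (x : R) (1 : R) (fun x => f x + g x) (df + dg).
Proof. exact: is_deriveD. Qed.

Lemma is_derive1M f g (df dg x : R) :
  is_derive (x : R) (1 : R) f df -> is_derive (x : R) (1 : R) g dg ->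
  is_derive (x : R) (1 : R) (fun x => f x * g x) (df * g x + f x * dg).
Proof.
move=> hf hg; apply: (is_derive_eq (is_deriveM hf hg)).
by rewrite /GRing.scale/=; ring.
Qed.

Lemma is_derive1V f (df x : R) : f x != 0 -> is_derive (x : R) (1 : R) f df ->
  is_derive (x : R) (1 : R) (fun x => (f x)^-1) (- df * ((f x)^-1 * (f x)^-1)).
Proof.
move=> f0 hf; have d : derivable f x 1 by exact: (@ex_derive _ _ _ _ _ _ _ hf).
apply: DeriveDef; first exact: derivableV.
rewrite deriveV// derive_val /GRing.scale/= mulrC !mulrN mulNr; congr (- (_ * _)).
by rewrite expr2 invfM.
Qed.

Lemma smooth_closureP f : smooth_closure f -> smooth f.
Proof.
apply: smooth_coind => {}f.
elim => {f}.
- move=> f sf; exists (derive1 f); first exact/SCbase/smooth_derive1.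
  by move=> x; exact: smooth_is_derive.
- move=> f g sf [df sdf hf] sg [dg sdg hg]; exists (df \+ dg); first exact: SCadd.
  by move=> x; exact: is_derive1D.
- move=> f g sf [df sdf hf] sg [dg sdg hg].
  exists ((df \* g) \+ (f \* dg)); first by apply: SCadd; exact: SCmul.
  by move=> x; exact: is_derive1M.
- move=> f f0 sf [df sdf hf].
  exists ((fun x => (- 1) * df x) \* ((fun x => (f x)^-1) \* (fun x => (f x)^-1))).
    apply: SCmul; last by apply: SCmul; exact: SCinv.
    by apply: (@SCmul (cst (-1))) => //; apply: SCbase; exact: smooth_cst.
  by move=> x /=; rewrite mulN1r; exact: is_derive1V.
- move=> f g sf [df sdf hf] sg [dg sdg hg].
  exists ((df \o g) \* dg); first by apply: SCmul => //; exact: SCcomp.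
  by move=> x; exact: is_derive1_comp.
Qed.

Lemma smoothD f g : smooth f -> smooth g -> smooth (fun x => f x + g x).
Proof. by move=> sf sg; apply: smooth_closureP; apply: SCadd; exact: SCbase. Qed.

Lemma smoothM f g : smooth f -> smooth g -> smooth (fun x => f x * g x).
Proof. by move=> sf sg; apply: smooth_closureP; apply: SCmul; exact: SCbase. Qed.

Lemma smooth_comp f g : smooth f -> smooth g -> smooth (fun x => f (g x)).
Proof. by move=> sf sg; apply: smooth_closureP; apply: SCcomp; exact: SCbase. Qed.

Lemma smoothV f : (forall x, f x != 0) -> smooth f -> smooth (fun x => (f x)^-1).
Proof. by move=> f0 sf; apply: smooth_closureP; apply: SCinv => //; exact: SCbase. Qed.

Lemma smoothN f : smooth f -> smooth (fun x => - f x).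
Proof.
move=> sf; under eq_fun do rewrite -mulN1r.
by apply: smoothM => //; exact: smooth_cst.
Qed.

Lemma smoothB f g : smooth f -> smooth g -> smooth (fun x => f x - g x).
Proof. by move=> sf sg; apply: smoothD => //; exact: smoothN. Qed.

Lemma smooth_id : smooth id.
Proof.
apply: (@smooth_coind [set f | f = id \/ exists c : R, f = cst c]); last by left.
move=> _ [->|[c ->]].
  by exists (cst 1); [right; exists 1|move=> x; exact: is_derive_id].
by exists (cst 0); [right; exists 0|move=> x; exact: is_derive_cst].
Qed.

End Smooth.

(** * A smooth step *)

Section Flat.
Context {R : realType}.

(** With [p = 1] this is the usual function exp(-1/x) on x > 0, extended by 0.  The
    polynomial factor in 1/x makes the family closed under differentiation. *)
Definition flat (p : {poly R}) (x : R) : R :=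
  if 0 < x then p.[x^-1] * expR (- x^-1) else 0.

Lemma horner_le_power (p : {poly R}) :
  exists n M, 0 <= M /\ forall t, 1 <= t -> `|p.[t]| <= M * t ^+ n.
Proof.
elim/poly_ind: p => [|p c [n [M [M0 hM]]]].
  by exists 0%N, 0; split=> // t _; rewrite horner0 normr0 mul0r.
exists n.+1, (M + `|c|); split; first by rewrite addr_ge0.
move=> t t1; rewrite hornerMXaddC (le_trans (ler_normD _ _))// mulrDl lerD//.
  rewrite normrM (ger0_norm (le_trans ler01 t1)) exprSr mulrA ler_wpM2r//.
    exact: le_trans t1.
  exact: hM.
by rewrite ler_peMr// exprn_ege1.
Qed.

(** With t = 1/x, the exponential beats the power t^n by one more factor t. *)
Lemma flat_le_id (p : {poly R}) :
  exists2 M : R, 0 <= M & forall x, 0 < x <= 1 -> `|flat p x| <= M * x.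
Proof.
have [n [M [M0 hM]]] := horner_le_power p.
exists (M * n.+1`!%:R); first by rewrite mulr_ge0.
move=> x /andP[x0 x1]; rewrite /flat x0.
set t := x^-1; have t1 : 1 <= t by rewrite invf_ge1.
have t0 : 0 < t by exact: lt_le_trans t1.
rewrite normrM (ger0_norm (expR_ge0 _)) expRN ler_pdivrMr ?expR_gt0//.
apply: (le_trans (hM _ t1)); rewrite -!mulrA ler_wpM2l//.
have -> : t ^+ n = x * t ^+ n.+1 by rewrite exprS mulrA mulfV ?mul1r ?gt_eqF.
rewrite mulrCA ler_wpM2l ?(ltW x0)// mulrC -ler_pdivrMr ?ltr0n ?fact_gt0//.
by apply: le_trans (expR_ge1Dxn n (ltW t0)); rewrite lerDr.
Qed.

(** At 0 the difference quotient of [flat p] is [flat ('X * p)], which tends to 0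
    by [flat_le_id]. *)
Lemma flat_is_derive p x :
  is_derive (x : R) (1 : R) (flat p) (flat ('X^2 * (p - p^`())) x).
Proof.
have [x0|x0|->] := ltrgt0P x.
- refine (@near_eq_is_derive R R R (fun y => p.[y^-1] * expR (- y^-1)) (flat p) x 1 _ _ _).
    near=> y; rewrite /flat; case: ifPn => //; rewrite -leNgt leNgt => /negP[].
    by near: y; exact: lt_nbhsr.
  rewrite /flat x0.
  have dV := is_derive1V (lt0r_neq0 x0) (is_derive_id x (1:R)).
  have dp := is_derive1_comp (is_derive_poly p x^-1) dV.
  have dN : is_derive (x : R) (1 : R) (fun y => - y^-1) (- (- 1 * (x^-1 / x))).
    exact: is_deriveN.
  have de := is_derive1_comp (f := expR) (g := fun y => - y^-1) (is_derive_expR _) dN.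
  apply: (is_derive_eq (is_derive1M dp de)).
  by rewrite /= !hornerE /=; ring.
- refine (@near_eq_is_derive R R R (cst 0) (flat p) x 1 _ _ _).
    near=> y; rewrite /flat; case: ifPn => // /lt_trans.
    move=> /(_ 0); have : y < 0 by near: y; exact: lt_nbhsl.
    by move=> y0 /(_ y0); rewrite ltxx.
  by rewrite /flat ltNge (ltW x0)/=; exact: is_derive_cst.
have [M M0 hM] := flat_le_id ('X * p).
rewrite {2}/flat ltxx.
suff h : h^-1 *: (flat p (h *: 1 + 0) - flat p 0) @[h --> (0:R)^'] --> (0:R).
  apply: DeriveDef; first by apply/cvg_ex; exists 0; move: h; apply: cvg_trans.
  by apply/cvg_lim => //; move: h; apply: cvg_trans.
apply/cvgr0Pnorm_le => e e0; near=> h.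
rewrite /GRing.scale/= mulr1 addr0 {2}/flat ltxx subr0.
have h1 : `|h| <= 1 by near: h; apply: dnbhs0_le.
have h2 : `|h| <= e / (M + 1) by near: h; apply: dnbhs0_le; rewrite divr_gt0// ltr_wpDl.
have [h0|h0] := ltP 0 h; last by rewrite /flat ltNge h0 mulr0 normr0 ltW.
have -> : h^-1 * flat p h = flat ('X * p) h by rewrite /flat h0 hornerM hornerX mulrA.
rewrite (ger0_norm (ltW h0)) in h1 h2.
apply: (le_trans (hM _ _)); first by rewrite h0.
apply: (@le_trans _ _ ((M + 1) * h)); first by rewrite ler_wpM2r ?(ltW h0)// lerDl.
by rewrite mulrC -ler_pdivlMr// ltr_wpDl.
Unshelve. all: by end_near. Qed.

Lemma smooth_flat p : smooth (flat p).
Proof.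
apply: (@smooth_coind _ [set f | exists q, f = flat q]); last by exists p.
move=> _ [q ->]; exists (flat ('X^2 * (q - q^`()))); first by eexists.
exact: flat_is_derive.
Qed.

Lemma flat1_gt0 x : 0 < x -> 0 < flat 1 x.
Proof. by move=> x0; rewrite /flat x0 hornerC mul1r expR_gt0. Qed.

Lemma flat1_le0 x : x <= 0 -> flat 1 x = 0.
Proof. by move=> x0; rewrite /flat ltNge x0. Qed.

Lemma flat1_ge0 x : 0 <= flat 1 x.
Proof. by case: (lerP x 0) => [/flat1_le0 ->|/flat1_gt0/ltW]. Qed.

(** Smooth, 0 on ]-oo, 0] and 1 on [1, +oo[. *)
Definition step (x : R) : R := flat 1 x * (flat 1 x + flat 1 (1 - x))^-1.

Lemma step_denom_gt0 x : 0 < flat 1 x + flat 1 (1 - x).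
Proof.
have [x0|x0] := ltP 0 x; first by rewrite ltr_pwDl ?flat1_gt0 ?flat1_ge0.
by rewrite ltr_wpDl ?flat1_ge0 ?flat1_gt0//; lra.
Qed.

Lemma smooth_step : smooth step.
Proof.
apply: smoothM; first exact: smooth_flat.
apply: smoothV; first by move=> x; rewrite gt_eqF ?step_denom_gt0.
apply: smoothD; first exact: smooth_flat.
apply: smooth_comp; first exact: smooth_flat.
by apply: smoothB; [exact: smooth_cst|exact: smooth_id].
Qed.

Lemma step_le0 x : x <= 0 -> step x = 0.
Proof. by move=> x0; rewrite /step flat1_le0// mul0r. Qed.

Lemma step_ge1 x : 1 <= x -> step x = 1.
Proof.
move=> x1; rewrite /step (@flat1_le0 (1 - x)); last by lra.
by rewrite addr0 divff// gt_eqF// flat1_gt0// (lt_le_trans ltr01).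
Qed.

Lemma step_ge0 x : 0 <= step x.
Proof. by rewrite divr_ge0 ?flat1_ge0 // ltW ?step_denom_gt0. Qed.

Lemma step_le1 x : step x <= 1.
Proof.
by rewrite ler_pdivrMr ?step_denom_gt0// mul1r lerDl flat1_ge0.
Qed.

End Flat.

(** * Integrable and square-integrable functions on the line *)

Section Integration.
Context {R : realType}.
Implicit Types f g h : R -> R.

Definition L2 f :=
  measurable_fun setT f /\ (\int[@lebesgue_measure R]_x (f x ^+ 2)%:E < +oo)%E.

Lemma integrable_dominated f g : measurable_fun setT f ->
  (forall x, `|f x| <= g x) -> L1 g -> L1 f.
Proof.
move=> mf fg; apply: le_integrable => //; first exact/measurable_EFinP.
by move=> x _ /=; rewrite lee_fin (le_trans (fg x))// ler_norm.
Qed.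

Lemma integrable_add f g : L1 f -> L1 g ->
  L1 (fun x => f x + g x).
Proof. by move=> hf hg; exact: (integrableD measurableT hf hg). Qed.

Lemma integrable_scale c f : L1 f -> L1 (fun x => c * f x).
Proof. by move=> hf; exact: (integrableZl measurableT c hf). Qed.

Lemma integrable_opp f : L1 f -> L1 (fun x => - f x).
Proof. by move=> /(integrable_scale (-1)); under eq_fun do rewrite mulN1r. Qed.

Lemma intgD f g : L1 f -> L1 g ->
  intg (fun x => f x + g x) = intg f + intg g.
Proof. exact: RintegralD. Qed.

Lemma intgZ c f : L1 f -> intg (fun x => c * f x) = c * intg f.
Proof. exact: RintegralZl. Qed.

Lemma intgN f : L1 f -> intg (fun x => - f x) = - intg f.
Proof. by move=> hf; rewrite -mulN1r -intgZ//; apply: eq_Rintegral => x _; rewrite mulN1r. Qed.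

Lemma integrable_sqr f : L2 f -> L1 (fun x => f x ^+ 2).
Proof.
move=> [mf foo]; apply/integrableP; split.
  by apply/measurable_EFinP; exact: measurable_funX.
apply: le_lt_trans foo; rewrite le_eqVlt; apply/orP; left; apply/eqP.
by apply: eq_integral => x _ /=; rewrite ger0_norm// sqr_ge0.
Qed.

Lemma L2P f : measurable_fun setT f -> L1 (fun x => f x ^+ 2) -> L2 f.
Proof.
move=> mf /integrableP[_ foo]; split=> //.
apply: le_lt_trans foo; rewrite le_eqVlt; apply/orP; left; apply/eqP.
by apply: eq_integral => x _ /=; rewrite ger0_norm// sqr_ge0.
Qed.

Lemma L2_dominated f g : measurable_fun setT f ->
  (forall x, `|f x| <= g x) -> L2 g -> L2 f.
Proof.
move=> mf fg /integrable_sqr g2; apply: L2P => //.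
apply: integrable_dominated g2; first exact: measurable_funX.
by move=> x; rewrite normrX ler_pXn2r ?nnegrE ?(le_trans _ (fg x)).
Qed.

Lemma integrable_L2M f g : L2 f -> L2 g -> L1 (fun x => f x * g x).
Proof.
move=> hf hg.
apply: (@integrable_dominated _ (fun x => f x ^+ 2 + g x ^+ 2)).
- by apply: measurable_funM; [case: hf|case: hg].
- move=> x; rewrite normrM -(real_normK (num_real (f x))) -(real_normK (num_real (g x))).
  by have := sqr_ge0 (`|f x| - `|g x|); have := normr_ge0 (f x);
    have := normr_ge0 (g x); nra.
- by apply: integrable_add; exact: integrable_sqr.
Qed.

Lemma L2_scale c f : L2 f -> L2 (fun x => c * f x).
Proof.
move=> hf; apply: L2P.
  by apply: measurable_funM => //; case: hf.
under eq_fun do rewrite exprMn.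
exact/integrable_scale/integrable_sqr.
Qed.

Lemma L2_abs f : L2 f -> L2 (fun x => `|f x|).
Proof.
move=> hf; apply: L2P; first by apply: measurableT_comp => //; case: hf.
by under eq_fun do rewrite real_normK ?num_real//; exact: integrable_sqr.
Qed.

Lemma dominated_intg (F : nat -> R -> R) f g :
  (forall n, measurable_fun setT (F n)) ->
  (forall x, F n x @[n --> \oo] --> f x) ->
  L1 g -> (forall n x, `|F n x| <= g x) ->
  intg (F n) @[n --> \oo] --> intg f.
Proof.
move=> mF Ff ig Fg.
have mf : measurable_fun setT f by apply: (measurable_fun_cvg mF) => x _; exact: Ff.
have [| | | | |intf _ h] := @dominated_convergence _ _ _ (@lebesgue_measure R) setT
  measurableT (fun n => EFin \o F n) (EFin \o f) (EFin \o g).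
- by move=> n; apply/measurable_EFinP; exact: mF.
- by apply/measurable_EFinP.
- by apply: aeW => x _; apply: cvg_EFin; [exact: nearW|exact: Ff].
- by [].
- by apply: aeW => x n _; rewrite /= lee_fin.
rewrite /Rintegral; apply: fine_cvg; rewrite fineK; first exact: h.
exact: integrable_fin_num.
Qed.

Lemma continuous_itv_bounded f a b : continuous f ->
  exists2 M, 0 <= M & forall x, a <= x <= b -> `|f x| <= M.
Proof.
move=> cf; have [ab|ba] := leP a b; last first.
  by exists 0 => // x /andP[ax xb]; have := le_trans ax xb; rewrite leNgt ba.
have cn : {within `[a, b], continuous (fun x => `|f x|)}.
  apply: continuous_subspaceT => x.
  by apply: continuous_comp; [exact: cf|exact: norm_continuous].
have [c _ hc] := EVT_max ab cn.
exists `|f c| => // x xab; exact: hc.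
Qed.

Definition vanishes_beyond f (N : R) := forall x, N <= `|x| -> f x = 0.

Lemma integrable_vanish f N : continuous f -> vanishes_beyond f N -> L1 f.
Proof.
move=> cf fN.
have -> : EFin \o f = (EFin \o f) \_ `[- N, N].
  apply/funext => x; rewrite patchE; case: ifPn => //.
  rewrite notin_setE/= in_itv/= -ler_norml => /negP; rewrite -ltNge => /ltW.
  by move=> /fN ->.
suff : mu.-integrable `[- N, N] (EFin \o f) by move/integrable_mkcond; exact.
apply: continuous_compact_integrable; first exact: segment_compact.
exact: continuous_subspaceT.
Qed.

Lemma L2_vanish f N : continuous f -> vanishes_beyond f N -> L2 f.
Proof.
move=> cf fN; apply: L2P; first exact: continuous_measurable_fun.
apply: (@integrable_vanish _ N).
  move=> x; apply: (@continuous_comp _ _ _ f (fun y => y ^+ 2)); first exact: cf.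
  exact: exprn_continuous.
by move=> x Nx; rewrite fN// expr0n.
Qed.

Lemma intg_itv f a b : (forall x, ~~ (a <= x <= b) -> f x = 0) ->
  intg f = Rintegral mu `[a, b] f.
Proof.
move=> h; rewrite [RHS]Rintegral_mkcond; congr (Rintegral _ _ _).
apply/funext => x; rewrite patchE; case: ifPn => //.
by rewrite notin_setE/= in_itv/= => /negP /h.
Qed.

Lemma intg_deriv_itv f (df : R -> R) a b : a < b -> continuous df ->
  (forall x, is_derive (x : R) (1 : R) f (df x)) ->
  Rintegral mu `[a, b] df = f b - f a.
Proof.
move=> ab cdf hf.
have cf : continuous f.
  move=> x; apply/differentiable_continuous/derivable1_diffP.
  exact: (@ex_derive _ _ _ _ _ _ _ (hf x)).
rewrite /Rintegral (@continuous_FTC2 _ df f)//.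
- exact: continuous_subspaceT.
- split; first by move=> x _; exact: (@ex_derive _ _ _ _ _ _ _ (hf x)).
  + exact/cvg_at_right_filter/cf.
  + exact/cvg_at_left_filter/cf.
- by move=> x _; rewrite (is_derive1_fun hf).
Qed.

End Integration.

(** * Test functions *)

Section TestFunctions.
Context {R : realType}.
Implicit Types (phi f g : R -> R).

(** Compact support is used in the form: zero outside a bounded interval. *)
Lemma test_functionP phi :
  test_function phi <-> smooth phi /\ exists N, vanishes_beyond phi N.
Proof.
split=> -[sphi].
  move=> /compact_bounded[N [_ hN]]; split=> //.
  exists (`|N| + 2) => x Nx; apply/eqP/negPn/negP => phix.
  have cx : closure [set x | phi x != 0] x by exact: subset_closure.
  have NN : N < `|N| + 1 by rewrite (le_lt_trans (ler_norm _))// ltrDl.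
  have := hN _ NN x cx; rewrite /= leNgt (lt_le_trans _ Nx)//.
  by rewrite ltrD2l ltr1n.
move=> [N hN]; split=> //.
apply: (@subclosed_compact _ _ `[- N, N]).
- exact: closed_closure.
- exact: segment_compact.
- have /closure_id -> : closed `[- N, N] by exact: itv_closed.
  apply: closureS => x /= phix; rewrite in_itv/= -ler_norml leNgt.
  by apply: contra phix => /ltW/hN ->.
Qed.

Lemma test_function_smooth phi : test_function phi -> smooth phi.
Proof. by case. Qed.

(** The margin 1 keeps a whole neighbourhood of x beyond N. *)
Lemma vanishes_derive1 phi N : smooth phi -> vanishes_beyond phi N ->
  vanishes_beyond (derive1 phi) (N + 1).
Proof.
move=> sphi hN x Nx.
rewrite derive1E (@near_eq_derive _ _ _ _ (cst 0)) ?derive_cst//.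
have Nx' : N < `|x| by rewrite (lt_le_trans _ Nx)// ltrDl.
have : \forall y \near x, N < `|y| by exact: (@cvgr_norm_gt _ _ _ (nbhs x) _ id x cvg_id).
by apply: filterS => y /ltW /hN.
Qed.

Lemma test_function_derive1 phi : test_function phi -> test_function (derive1 phi).
Proof.
move=> /test_functionP[sphi [N hN]]; apply/test_functionP.
by split; [exact: smooth_derive1|exists (N + 1); exact: vanishes_derive1].
Qed.

Lemma test_functionM phi f : test_function phi -> smooth f ->
  test_function (fun x => phi x * f x).
Proof.
move=> /test_functionP[sphi [N hN]] sf; apply/test_functionP; split.
  exact: smoothM.
by exists N => x Nx; rewrite hN// mul0r.
Qed.

Lemma integrable_test phi : test_function phi -> L1 phi.
Proof.
move=> /test_functionP[sphi [N hN]]; apply: integrable_vanish hN.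
exact: smooth_continuous.
Qed.

Lemma L2_test phi : test_function phi -> L2 phi.
Proof.
move=> /test_functionP[sphi [N hN]]; apply: L2_vanish hN.
exact: smooth_continuous.
Qed.

Lemma intg_derive1_test phi : test_function phi -> intg (derive1 phi) = 0.
Proof.
move=> /test_functionP[sphi [N hN]].
have h0 := vanishes_derive1 sphi hN.
pose M := `|N| + 2.
have M0 : 0 < M by rewrite ltr_wpDl.
have NM : N + 1 <= M by rewrite lerD ?ler_norm ?ler1n.
rewrite (@intg_itv _ _ (- M) M); last first.
  move=> x; rewrite -ler_norml -ltNge => /ltW Mx.
  by rewrite h0// (le_trans NM).
rewrite (@intg_deriv_itv _ phi _ _ _ _ _ (fun x => smooth_is_derive x sphi)).
- by rewrite !hN ?subrr ?normrN// (ger0_norm (ltW M0)) (le_trans _ NM)// lerDl ler01.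
- by rewrite (lt_trans _ M0)// oppr_lt0.
- exact/smooth_continuous/smooth_derive1.
Qed.

(** The product phi f is a test function, so its derivative has integral 0.  In
    particular the classical derivative of a test function is a weak one. *)
Lemma intg_test_by_parts phi f : test_function phi -> smooth f ->
  intg (fun x => phi x * derive1 f x) = - intg (fun x => derive1 phi x * f x).
Proof.
move=> tphi sf; apply/eqP; rewrite -addr_eq0 -intgD; last 2 first.
- by apply/integrable_test/test_functionM => //; exact: smooth_derive1.
- by apply/integrable_test/test_functionM => //; exact: test_function_derive1.
rewrite -(intg_derive1_test (test_functionM tphi sf)); apply/eqP.
apply: eq_Rintegral => x _; rewrite addrC; apply/esym.
have h := is_derive1M (smooth_is_derive x (test_function_smooth tphi)) (smooth_is_derive x sf).
exact: derive1_val h.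
Qed.

End TestFunctions.

(** * The fundamental lemma of the calculus of variations *)

Section Fundamental.
Context {R : realType}.
Implicit Types f g phi : R -> R.

Lemma smooth_affine f (c d : R) : smooth f -> smooth (fun x => f (c * x + d)).
Proof.
move=> sf; apply: smooth_comp => //; apply: smoothD; last exact: smooth_cst.
by apply: smoothM; [exact: smooth_cst|exact: smooth_id].
Qed.

Lemma smooth_measurable f : smooth f -> measurable_fun setT f.
Proof. by move=> /smooth_continuous; exact: continuous_measurable_fun. Qed.

Lemma cvg_near_cst (u : nat -> R) (l : R) :
  (\forall n \near \oo, u n = l) -> u n @[n --> \oo] --> l.
Proof.
move=> h; apply: (@cvg_trans _ (l @[n --> \oo])); last exact: cvg_cst.
by apply: near_eq_cvg; apply: filterS h => n ->.
Qed.

Lemma near_large_nat (c : R) : \forall n \near \oo, c <= n.+1%:R.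
Proof.
near=> n; rewrite (@le_trans _ _ n%:R) ?ler_nat//.
by near: n; exact: nbhs_infty_ger.
Unshelve. all: by end_near. Qed.

Lemma locally_integrable_itv g a b : locally_integrable setT g ->
  mu.-integrable `[a, b] (EFin \o g).
Proof.
move=> [mg _ hg]; apply/integrableP; split.
  by apply/measurable_EFinP; exact: measurable_funS mg.
by have := hg `[a, b]%classic (@subsetT _ _) (@segment_compact _ a b).
Qed.

Lemma integrable_abs_indic g a b : locally_integrable setT g ->
  L1 (fun x => `|g x| * \1_(`[a, b]%classic) x).
Proof.
move=> lg.
have -> : EFin \o (fun x => `|g x| * \1_(`[a, b]%classic) x) =
          (abse \o (EFin \o g)) \_ `[a, b].
  apply/funext => x; rewrite patchE/= indicE; case: ifPn => _.
    by rewrite mulr1.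
  by rewrite mulr0.
have := integrable_abse (locally_integrable_itv a b lg).
by move/integrable_mkcond; exact.
Qed.

(** Test functions converging pointwise to the indicator of ]a, b], whose product
    with g has integral 0 in the fundamental lemma. *)
Definition window a b n (x : R) : R :=
  step (n.+1%:R * (x - a)) * step (n.+1%:R * (b - x) + 1).

Lemma test_window a b n : test_function (window a b n).
Proof.
apply/test_functionP; split.
  rewrite /window; apply: smoothM.
    under eq_fun do rewrite mulrBr.
    exact: smooth_affine smooth_step.
  under eq_fun do rewrite mulrBr addrAC addrC -mulNr.
  exact: smooth_affine smooth_step.
exists (`|a| + `|b| + 1) => x hx; rewrite /window.
have n0 : 1 <= n.+1%:R :> R by rewrite ler1n.
have [xa|ax] := leP x a.
  by rewrite step_le0 ?mul0r// mulr_ge0_le0// subr_le0.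
rewrite (@step_le0 _ (_ + 1)) ?mulr0//.
have : 1 <= x - b.
  have ha := ler_norm a; have hb := ler_norm b; have hc := ler_norm (- a).
  rewrite normrN in hc; have hd := normr_ge0 b.
  by move: hx; rewrite ler_normr => /orP[] h; lra.
by nra.
Qed.

Lemma window_cvg a b x :
  window a b n x @[n --> \oo] --> (\1_(`]a, b]%classic) x : R).
Proof.
apply: cvg_near_cst; rewrite indicE.
have [xa|ax] := leP x a.
  near=> n; rewrite /window step_le0 ?mul0r; last first.
    by rewrite mulr_ge0_le0// subr_le0.
  by rewrite memNset//= in_itv/= ltNge xa.
have [xb|bx] := leP x b.
  near=> n; rewrite mem_set/=; last by rewrite in_itv/= ax xb.
  rewrite /window !step_ge1 ?mulr1//.
    by rewrite lerDr mulr_ge0// subr_ge0.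
  rewrite -ler_pdivrMr ?subr_gt0// div1r.
  by near: n; exact: near_large_nat.
near=> n; rewrite memNset/=; last by rewrite in_itv/= ax/= leNgt bx.
rewrite /window (@step_le0 _ (_ + 1)) ?mulr0//.
rewrite -lerBrDr sub0r -opprB mulrN lerN2 -ler_pdivrMr ?subr_gt0// div1r.
by near: n; exact: near_large_nat.
Unshelve. all: by end_near. Qed.

Lemma window_le a b n x : `|window a b n x| <= \1_(`[a, b + 1]%classic) x.
Proof.
rewrite indicE ger0_norm /window; last by apply: mulr_ge0; exact: step_ge0.
have n0 : 1 <= n.+1%:R :> R by rewrite ler1n.
have [xa|ax] := ltP x a.
  by rewrite step_le0 ?mul0r// mulr_ge0_le0// subr_le0 ltW.
have [xb|bx] := leP x (b + 1).
  rewrite mem_set/=; last by rewrite in_itv/= ax.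
  by rewrite mulr_ile1 ?step_ge0 ?step_le1.
by rewrite (@step_le0 _ (_ + 1)) ?mulr0//; nra.
Qed.

(** Testing against the [window] functions shows that the primitives of g vanish;
    by Lebesgue differentiation g is almost everywhere the derivative of such a
    primitive. *)
Lemma fundamental_lemma g : locally_integrable setT g ->
  (forall phi, test_function phi -> intg (fun x => g x * phi x) = 0) ->
  {ae lebesgue_measure, forall x, g x = 0}.
Proof.
move=> lg hg.
have mg : measurable_fun setT g by case: lg.
have itv0 a b : Rintegral mu `]a, b] g = 0.
  have h : intg (fun x => g x * window a b n x) @[n --> \oo] -->
           intg (fun x => g x * \1_(`]a, b]%classic) x).
    apply: (@dominated_intg _ _ _ (fun x => `|g x| * \1_(`[a, b + 1]%classic) x)).
    - move=> n; apply: measurable_funM => //.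
      by apply: smooth_measurable; apply: test_function_smooth; exact: test_window.
    - by move=> x; apply: cvgM; [exact: cvg_cst|exact: window_cvg].
    - exact: integrable_abs_indic.
    - by move=> n x; rewrite normrM ler_wpM2l// window_le.
  have z : intg (fun x => g x * window a b n x) @[n --> \oo] --> (0 : R).
    by apply: cvg_near_cst; apply: nearW => n; apply: hg; exact: test_window.
  rewrite [RHS](cvg_unique _ z h) //.
  rewrite [LHS]Rintegral_mkcond; congr (Rintegral _ _ _); apply/funext => x.
  by rewrite patchE indicE; case: ifPn => _; rewrite ?mulr1 ?mulr0.
have := lebesgue_differentiation lg.
apply: filterS; first exact: (ae_filter_ringOfSetsType (@lebesgue_measure R)).
move=> x gx.
have [|||_] := @FTC1_lebesgue_pt _ g (BRight (x - 1)) x (x + 1) _ _ _ gx.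
- by rewrite ltrDl.
- apply: integrableS (locally_integrable_itv (x - 1) (x + 1) lg) => //.
  exact: subset_itv_oc_cc.
- by rewrite lte_fin ltrBlDr ltrDl.
move=> <-.
have -> : (fun y => Rintegral mu [set` Interval (BRight (x - 1)) (BRight y)] g) = cst 0.
  by apply/funext => y; exact: itv0.
by rewrite derive1_cst.
Qed.

End Fundamental.

(** * Approximating a function that is smooth on either side of a point *)

Section Gluing.
Context {R : realType}.
Implicit Types (f g phi P Q D v w : R -> R) (a : R).

Lemma derive1_cst_near f (c x : R) : (\forall y \near x, f y = c) -> derive1 f x = 0.
Proof.
move=> h; rewrite derive1E (@near_eq_derive _ _ _ _ (cst c)) ?derive_cst//.
Qed.

Lemma derive1_step_out x : ~~ (0 <= x <= 1) -> derive1 step x = 0 :> R.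
Proof.
rewrite negb_and -!ltNge => /orP[x0|x1].
- apply: (@derive1_cst_near _ 0); near=> y; apply: step_le0; apply: ltW.
  by near: y; exact: lt_nbhsl.
- apply: (@derive1_cst_near _ 1); near=> y; apply: step_ge1; apply: ltW.
  by near: y; exact: lt_nbhsr.
Unshelve. all: by end_near. Qed.

Lemma vanish_bounded f N : continuous f -> vanishes_beyond f N ->
  exists2 M, 0 <= M & forall x, `|f x| <= M.
Proof.
move=> cf fN; have [M M0 hM] := continuous_itv_bounded (- N) N cf.
exists M => // x; have [xN|Nx] := leP `|x| N.
  by apply: hM; rewrite -ler_norml.
by rewrite fN ?normr0// ltW.
Qed.

Lemma derive1_step_bounded :
  exists2 M : R, 0 <= M & forall x, `|derive1 step x| <= M.
Proof.
apply: (@vanish_bounded _ 2); first exact/smooth_continuous/smooth_derive1/smooth_step.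
move=> x; rewrite ler_normr => h; apply: derive1_step_out.
by apply/negP => /andP[x0 x1]; case/orP: h; lra.
Qed.

(** A cutoff: 1 on [-1, 1] and 0 outside [-2, 2]. *)
Definition plateau (y : R) : R := step (y + 2) * step (- y + 2).

Lemma smooth_plateau : smooth plateau.
Proof.
apply: smoothM.
  by under eq_fun do rewrite -[X in X + _]mul1r; exact: smooth_affine smooth_step.
by under eq_fun do rewrite -[X in X + _]mulN1r; exact: smooth_affine smooth_step.
Qed.

Lemma plateau1 y : `|y| <= 1 -> plateau y = 1.
Proof.
by rewrite ler_norml => /andP[h1 h2]; rewrite /plateau !step_ge1 ?mulr1//; lra.
Qed.

Lemma plateau_vanishes : vanishes_beyond plateau 2.
Proof.
move=> y; rewrite ler_normr => /orP[] h; rewrite /plateau.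
  by rewrite (@step_le0 _ (- y + 2)) ?mulr0//; lra.
by rewrite step_le0 ?mul0r//; lra.
Qed.

Lemma plateau_le1 y : `|plateau y| <= 1.
Proof.
rewrite ger0_norm; last by apply: mulr_ge0; exact: step_ge0.
by apply: mulr_ile1; rewrite ?step_ge0 ?step_le1.
Qed.

Lemma derive1_plateau_bounded :
  exists2 M : R, 0 <= M & forall x, `|derive1 plateau x| <= M.
Proof.
apply: (@vanish_bounded _ (2 + 1)).
  exact/smooth_continuous/smooth_derive1/smooth_plateau.
exact: vanishes_derive1 smooth_plateau plateau_vanishes.
Qed.

Definition piecewise a P Q x := if x <= a then Q x else P x.

(** Smooth interpolation from Q (left of a) to P (right of a + 1/(n + 1)). *)
Definition blend a P Q n x := Q x + step (n.+1%:R * (x - a)) * (P x - Q x).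

Lemma smooth_blend a P Q n : smooth P -> smooth Q -> smooth (blend a P Q n).
Proof.
move=> sP sQ; apply: (smoothD sQ); apply: (smoothM _ (smoothB sP sQ)).
under eq_fun do rewrite mulrBr; exact: smooth_affine smooth_step.
Qed.

Lemma blend_cvg a P Q x : blend a P Q n x @[n --> \oo] --> piecewise a P Q x.
Proof.
apply: cvg_near_cst; rewrite /piecewise /blend.
have [xa|ax] := leP x a.
  near=> n; rewrite step_le0 ?mul0r ?addr0//.
  by rewrite mulr_ge0_le0// subr_le0.
near=> n; rewrite step_ge1 ?mul1r ?subrKC// -ler_pdivrMr ?subr_gt0// div1r.
by near: n; exact: near_large_nat.
Unshelve. all: by end_near. Qed.

(** A blend is at each point a convex combination of P and Q, and involves only
    those of the two that are bounded by D there. *)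
Lemma blend_le a P Q D n x :
  (forall x, a <= x -> `|P x| <= D x) -> (forall x, x <= a + 1 -> `|Q x| <= D x) ->
  `|blend a P Q n x| <= D x.
Proof.
move=> hP hQ; rewrite /blend.
have n0 : 1 <= n.+1%:R :> R by rewrite ler1n.
have [xa|ax] := leP x a.
  rewrite step_le0 ?mul0r ?addr0; first by apply: hQ; lra.
  by rewrite mulr_ge0_le0// subr_le0.
have {}hP := hP x (ltW ax).
have [xa1|ax1] := leP (a + 1) x.
  by rewrite step_ge1 ?mul1r ?subrKC//; nra.
have {}hQ := hQ x (ltW ax1).
move: (step_ge0 (n.+1%:R * (x - a))) (step_le1 (n.+1%:R * (x - a))).
move: (step _) => s s0 s1.
have -> : Q x + s * (P x - Q x) = s * P x + (1 - s) * Q x by ring.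
rewrite (le_trans (ler_normD _ _))// !normrM (ger0_norm s0).
have s1' : 0 <= 1 - s by rewrite subr_ge0.
rewrite (ger0_norm s1').
have := ler_wpM2l s0 hP; have := ler_wpM2l s1' hQ; lra.
Qed.

Lemma is_derive_affine f (c d x : R) : smooth f ->
  is_derive (x : R) (1 : R) (fun x => f (c * (x - d))) (c * derive1 f (c * (x - d))).
Proof.
move=> sf.
have h : is_derive (x : R) (1 : R) (fun x => c * (x - d)) c.
  apply: (is_derive_eq (is_derive1M (is_derive_cst c x (1:R))
    (is_derive1D (is_derive_id x (1 : R)) (is_derive_cst (- d) x (1:R))))).
  by rewrite mul0r add0r addr0 mulr1.
have := is_derive1_comp (f := f) (g := fun x => c * (x - d)) (smooth_is_derive _ sf) h.
by rewrite mulrC.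
Qed.

(** The derivative of the interpolating factor of [blend]: an approximate unit mass
    located in [a, a + 1/(n + 1)]. *)
Definition spike a n (x : R) : R := n.+1%:R * derive1 step (n.+1%:R * (x - a)).

Lemma smooth_spike a n : smooth (spike a n).
Proof.
apply: smoothM; first exact: smooth_cst.
under eq_fun do rewrite mulrBr.
exact/smooth_affine/smooth_derive1/smooth_step.
Qed.

Lemma spike_out a n x : ~~ (a <= x <= a + n.+1%:R^-1) -> spike a n x = 0.
Proof.
move=> h; rewrite /spike derive1_step_out ?mulr0//; apply: contra h.
have n0 : 0 < n.+1%:R :> R by rewrite ltr0n.
rewrite pmulr_rge0// subr_ge0 => /andP[-> /=].
by rewrite mulrC -ler_pdivlMr// div1r lerBlDl.
Qed.

(** The test functions that approximate [piecewise a P Q]. *)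
Definition cutoff a P Q n x := plateau (n.+1%:R^-1 * (x - a)) * blend a P Q n x.

Lemma test_cutoff a P Q n : smooth P -> smooth Q -> test_function (cutoff a P Q n).
Proof.
move=> sP sQ; apply/test_functionP; split.
  apply: smoothM; last exact: smooth_blend.
  under eq_fun do rewrite mulrBr; exact: smooth_affine smooth_plateau.
exists (`|a| + n.+1%:R * 2) => x hx.
rewrite /cutoff plateau_vanishes ?mul0r//.
have n0 : 0 < n.+1%:R :> R by rewrite ltr0n.
rewrite normrM ger0_norm ?invr_ge0// mulrC ler_pdivlMr// mulrC.
have := lerB_dist x a; lra.
Qed.

(** The cutoff factor is 1 on the support of the spike and is omitted there. *)
Lemma derive1_cutoff a P Q n x : smooth P -> smooth Q ->
  derive1 (cutoff a P Q n) x =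
  n.+1%:R^-1 * derive1 plateau (n.+1%:R^-1 * (x - a)) * blend a P Q n x +
  plateau (n.+1%:R^-1 * (x - a)) * blend a (derive1 P) (derive1 Q) n x +
  spike a n x * (P x - Q x).
Proof.
move=> sP sQ.
have d1 := is_derive_affine n.+1%:R^-1 a x smooth_plateau.
have d2 := is_derive_affine n.+1%:R a x smooth_step.
have dP := smooth_is_derive x sP; have dQ := smooth_is_derive x sQ.
have d3 : is_derive (x : R) (1 : R) (fun x => P x - Q x) (derive1 P x - derive1 Q x).
  exact: is_deriveB.
have d4 := is_derive1M d1 (is_derive1D dQ (is_derive1M d2 d3)).
rewrite (derive1_val d4) /blend -/(spike a n x).
have [/andP[ax xa]|/spike_out ->] := boolP (a <= x <= a + n.+1%:R^-1); last by ring.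
rewrite plateau1; first by ring.
have n0 : 0 < n.+1%:R :> R by rewrite ltr0n.
have n1 : n.+1%:R^-1 <= 1 :> R by rewrite invf_le1 ?ler1n.
have n2 : 0 < n.+1%:R^-1 :> R by rewrite invr_gt0.
rewrite ger0_norm; last by rewrite mulr_ge0 ?subr_ge0 ?(ltW n2).
apply: mulr_ile1; rewrite ?subr_ge0 ?(ltW n2)//.
by rewrite lerBlDl (le_trans xa)// lerD2l.
Qed.

(** The integrability of v and w is assumed separately, as square integrability. *)
Definition weak_pair v w :=
  forall phi, test_function phi ->
    intg (fun x => v x * derive1 phi x) = - intg (fun x => w x * phi x).

Lemma L2_piecewise a P Q D : smooth P -> smooth Q -> L2 D ->
  (forall x, a <= x -> `|P x| <= D x) -> (forall x, x <= a + 1 -> `|Q x| <= D x) ->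
  L2 (piecewise a P Q).
Proof.
move=> sP sQ L2D hP hQ; apply: (L2_dominated _ _ L2D).
  apply: (@measurable_fun_cvg _ _ _ _ (blend a P Q)).
    by move=> n; apply: smooth_measurable; exact: smooth_blend.
  by move=> x _; exact: blend_cvg.
move=> x; rewrite /piecewise; have [xa|xa] := leP x a; first by apply: hQ; lra.
by apply: hP; exact: ltW.
Qed.

(** The weak derivative relation, tested on [cutoff a P Q n], has four terms.  The
    one in w and the one with the blended derivatives converge by domination, and
    the one with the derivative of the plateau is O(1/n); so the remaining term,
    with the spike, converges as well, and the value of its limit is forced.
    Computing this limit in a second way gives the integration by parts. *)
Lemma spike_cvg a P Q D v w : L2 v -> L2 w -> weak_pair v w ->
  smooth P -> smooth Q -> L2 D ->
  (forall x, a <= x -> `|P x| <= D x) -> (forall x, x <= a + 1 -> `|Q x| <= D x) ->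
  (forall x, a <= x -> `|derive1 P x| <= D x) ->
  (forall x, x <= a + 1 -> `|derive1 Q x| <= D x) ->
  intg (fun x => v x * (spike a n x * (P x - Q x))) @[n --> \oo] -->
  - (intg (fun x => w x * piecewise a P Q x) +
     intg (fun x => v x * piecewise a (derive1 P) (derive1 Q) x)).
Proof.
move=> L2v L2w vw sP sQ L2D hP hQ hP' hQ'.
have mv : measurable_fun setT v by case: L2v.
have mw : measurable_fun setT w by case: L2w.
have [M M0 hM] := derive1_plateau_bounded.
have sblend n : smooth (blend a P Q n) by exact: smooth_blend.
have sblend' n : smooth (blend a (derive1 P) (derive1 Q) n).
  by apply: smooth_blend; exact: smooth_derive1.
pose pl n x := plateau (n.+1%:R^-1 * (x - a)).
have spl n : smooth (pl n).
  by rewrite /pl; under eq_fun do rewrite mulrBr; exact: smooth_affine smooth_plateau.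
pose pl' n x := n.+1%:R^-1 * derive1 plateau (n.+1%:R^-1 * (x - a)).
have spl' n : smooth (pl' n).
  apply: smoothM; first exact: smooth_cst.
  under eq_fun do rewrite mulrBr.
  exact/smooth_affine/smooth_derive1/smooth_plateau.
have pl_cvg x : pl n x @[n --> \oo] --> (1 : R).
  apply: cvg_near_cst; near=> n; apply: plateau1.
  rewrite normrM ger0_norm ?invr_ge0// mulrC ler_pdivrMr// mul1r.
  by near: n; exact: near_large_nat.
have abs_le (u : R -> R) (y d x : R) : `|y| <= d -> `|u x * y| <= `|u x| * d.
  by move=> h; rewrite normrM ler_wpM2l.
have L2abs u : L2 u -> L1 (fun x => `|u x| * D x).
  by move=> hu; apply: integrable_L2M => //; exact: L2_abs.
have plM n x (y d : R) : `|y| <= d -> `|pl n x * y| <= d.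
  by move=> h; rewrite normrM -[leRHS]mul1r ler_pM// plateau_le1.
have pl'M n x (y d : R) : `|y| <= d -> `|pl' n x * y| <= n.+1%:R^-1 * (M * d).
  move=> h; rewrite normrM mulrA ler_pM// normrM ger0_norm ?invr_ge0//.
  by rewrite ler_wpM2l ?invr_ge0.
have D0 x : 0 <= D x.
  have [/hP/(le_trans (normr_ge0 _))//|xa] := leP a x.
  by apply: (le_trans (normr_ge0 (Q x))); apply: hQ; lra.
(* A, B and C are the terms of the tested relation without the spike. *)
pose A n := intg (fun x => w x * cutoff a P Q n x).
pose B n := intg (fun x => v x * (pl' n x * blend a P Q n x)).
pose C n := intg (fun x => v x * (pl n x * blend a (derive1 P) (derive1 Q) n x)).
have Acvg : A n @[n --> \oo] --> intg (fun x => w x * piecewise a P Q x).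
  apply: (@dominated_intg _ _ _ (fun x => `|w x| * D x)).
  - move=> n; apply: measurable_funM => //.
    by apply: smooth_measurable; apply: test_function_smooth; exact: test_cutoff.
  - move=> x; apply: cvgM; first exact: cvg_cst.
    rewrite -[piecewise a P Q x]mul1r.
    by apply: cvgM; [exact: pl_cvg|exact: blend_cvg].
  - exact: L2abs.
  - by move=> n x; apply: abs_le; apply: plM; exact: blend_le.
have Bcvg : B n @[n --> \oo] --> (0 : R).
  have <- : intg (fun=> (0 : R)) = 0 by rewrite /Rintegral integral0.
  apply: (@dominated_intg _ _ _ (fun x => M * (`|v x| * D x))).
  - move=> n; apply: measurable_funM => //.
    by apply: smooth_measurable; exact: (smoothM (spl' n) (sblend n)).
  - move=> x; rewrite -(mulr0 (v x)).
    apply: cvgM; first exact: cvg_cst.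
    apply/norm_cvg0P.
    apply: (@squeeze_cvgr _ _ _ _ (cst 0) (fun n => n.+1%:R^-1 * (M * D x))).
    + by apply: nearW => n; rewrite normr_ge0/= pl'M//; exact: blend_le.
    + exact: cvg_cst.
    + rewrite -(mul0r (M * D x)).
      by apply: cvgM; [exact: cvg_harmonic|exact: cvg_cst].
  - exact/integrable_scale/L2abs.
  - move=> n x; rewrite [leRHS]mulrCA; apply: abs_le.
    apply: (le_trans (pl'M _ _ _ _ (blend_le n x hP hQ))).
    by rewrite ler_piMl ?mulr_ge0// invf_le1 ?ler1n.
have Ccvg : C n @[n --> \oo] --> intg (fun x => v x * piecewise a (derive1 P) (derive1 Q) x).
  apply: (@dominated_intg _ _ _ (fun x => `|v x| * D x)).
  - move=> n; apply: measurable_funM => //.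
    by apply: smooth_measurable; exact: (smoothM (spl n) (sblend' n)).
  - move=> x; apply: cvgM; first exact: cvg_cst.
    rewrite -[piecewise a _ _ x]mul1r.
    by apply: cvgM; [exact: pl_cvg|exact: blend_cvg].
  - exact: L2abs.
  - by move=> n x; apply: abs_le; apply: plM; exact: blend_le.
have L2B n : L2 (fun x => pl' n x * blend a P Q n x).
  apply: (L2_dominated _ _ (L2_scale (n.+1%:R^-1 * M) L2D)).
    by apply: smooth_measurable; exact: (smoothM (spl' n) (sblend n)).
  by move=> x; rewrite -[leRHS]mulrA; apply: pl'M; exact: blend_le.
have L2C n : L2 (fun x => pl n x * blend a (derive1 P) (derive1 Q) n x).
  apply: (L2_dominated _ _ L2D).
    by apply: smooth_measurable; exact: (smoothM (spl n) (sblend' n)).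
  by move=> x; apply: plM; exact: blend_le.
have key n : intg (fun x => v x * (spike a n x * (P x - Q x))) = - A n - B n - C n.
  have ta := test_cutoff a n sP sQ.
  have iv := integrable_L2M L2v (L2_test (test_function_derive1 ta)).
  have iB := integrable_L2M L2v (L2B n).
  have iC := integrable_L2M L2v (L2C n).
  rewrite /A -vw// -addrA -opprD -intgD// -intgN; last exact: integrable_add.
  rewrite -intgD//; last exact/integrable_opp/integrable_add.
  apply: eq_Rintegral => x _; rewrite derive1_cutoff// /pl /pl'.
  by ring.
rewrite (_ : - (_ + _) = - intg (fun x => w x * piecewise a P Q x) - 0 -
  intg (fun x => v x * piecewise a (derive1 P) (derive1 Q) x)); last by rewrite subr0 opprD.
under eq_cvg do rewrite key.
by apply: cvgB => //; apply: cvgB => //; apply: cvgN.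
Unshelve. all: by end_near. Qed.

End Gluing.

(** * Integration by parts against weak derivatives *)

Section ByParts.
Context {R : realType}.
Implicit Types (f g phi P Q D v w : R -> R) (a : R).

Lemma spike_le a : exists2 M : R, 0 <= M &
  forall n x, `|spike a n x| <= n.+1%:R * M.
Proof.
have [M M0 hM] := @derive1_step_bounded R; exists M => // n x.
by rewrite normrM ger0_norm// ler_wpM2l.
Qed.

Lemma intg_spike a n : intg (spike a n) = 1.
Proof.
have n0 : 0 < n.+1%:R^-1 :> R by rewrite invr_gt0.
rewrite (intg_itv (fun x => @spike_out _ a n x)).
rewrite (intg_deriv_itv _ _ (fun x => is_derive_affine n.+1%:R a x smooth_step)).
- by rewrite subrr mulr0 addrAC subrr add0r mulfV// step_ge1// step_le0// subr0.
- by rewrite ltrDl.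
- exact/smooth_continuous/smooth_spike.
Qed.

Lemma integrable_spike f a n : continuous f -> L1 (fun x => f x * spike a n x).
Proof.
move=> cf; apply: (@integrable_vanish _ _ (`|a| + 2)).
  by move=> x; apply: cvgM; [exact: cf|exact: smooth_continuous (@smooth_spike _ a n) x].
move=> x hx; rewrite spike_out ?mulr0//; apply/negP => /andP[ax xa].
have n1 : n.+1%:R^-1 <= 1 :> R by rewrite invf_le1 ?ler1n.
have xa1 : x <= a + 1 by rewrite (le_trans xa)// lerD2l.
clear xa; have h1 := ler_norm a; have h2 := ler_norm (- a); rewrite normrN in h2.
by move: hx; rewrite ler_normr => /orP[] hx; lra.
Qed.

(** The spike has integral 1 and absolute value at most (n + 1) M on an interval of
    length 1/(n + 1), so its integral against f - f(a) is at most M times the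
    oscillation of f there. *)
Lemma spike_delta f a : continuous f ->
  intg (fun x => f x * spike a n x) @[n --> \oo] --> f a.
Proof.
move=> cf; have [M M0 hM] := spike_le a.
apply/cvgrPdist_le => e e0.
have : \forall y \near a, `|f a - f y| <= e / (M + 1).
  by have /cvgrPdist_le := cf a; apply; rewrite divr_gt0// ltr_wpDl.
move=> -[d /= d0 hd].
near=> n.
have nd : n.+1%:R^-1 < d.
  rewrite invf_plt ?posrE//.
  apply: (@lt_le_trans _ _ (d^-1 + 1)); first by rewrite ltrDl.
  by near: n; exact: near_large_nat.
have n0 : 0 < n.+1%:R :> R by rewrite ltr0n.
have -> : f a - intg (fun x => f x * spike a n x) =
          intg (fun x => (f a - f x) * spike a n x).
  have i1 := integrable_spike a n cf.
  have i2 := integrable_spike a n (@cst_continuous _ _ (f a)).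
  have i3 : L1 (spike a n).
    have := integrable_spike a n (@cst_continuous _ _ (1 : R)).
    by under eq_fun do rewrite mul1r.
  rewrite -[X in X - _]mulr1 -(intg_spike a n) -intgZ// -intgN// -intgD//; last first.
    exact: integrable_opp.
  by apply: eq_Rintegral => x _; rewrite mulrBl.
have cg : continuous (fun x => (f a - f x) * spike a n x).
  move=> x; apply: cvgM; last exact: smooth_continuous (@smooth_spike _ a n) x.
  by apply: cvgB; [exact: cvg_cst|exact: cf].
have ig : mu.-integrable `[a, a + n.+1%:R^-1]
    (EFin \o (fun x => (f a - f x) * spike a n x)).
  apply: continuous_compact_integrable; first exact: segment_compact.
  exact: continuous_subspaceT.
rewrite (@intg_itv _ _ a (a + n.+1%:R^-1)); last first.
  by move=> x /spike_out ->; rewrite mulr0.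
apply: (le_trans (le_normr_Rintegral _ ig)) => //.
apply: (@le_trans _ _ (Rintegral (@lebesgue_measure R) `[a, a + n.+1%:R^-1]
   (fun=> e / (M + 1) * (n.+1%:R * M)))).
  apply: le_Rintegral => //.
  - exact: (integrable_norm ig).
  - apply: continuous_compact_integrable; first exact: segment_compact.
    by apply: continuous_subspaceT => x; exact: cvg_cst.
  - move=> x; rewrite /= in_itv/= => /andP[ax xa].
    rewrite normrM ler_pM//; apply: hd => /=.
    rewrite ler0_norm ?subr_le0// opprB.
    by rewrite (le_lt_trans _ nd)// lerBlDl.
rewrite Rintegral_cst//= lebesgue_measure_itv/= lte_fin ltrDl invr_gt0 n0.
rewrite -EFinB /= addrAC subrr add0r.
have M1 : 0 < M + 1 by rewrite ltr_wpDl.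
have kM (k : R) : 0 < k -> e / (M + 1) * (k * M) * k^-1 = e * M / (M + 1).
  by move=> k0; field; rewrite !gt_eqF.
rewrite kM// ler_pdivrMr//.
by rewrite ler_wpM2l ?(ltW e0)// lerDl.
Unshelve. all: by end_near. Qed.

(** When v is continuous, the spike term tends to v(a) times the jump of the
    piecewise function. *)
Lemma by_parts_jump a P Q D v w : continuous v ->
  L2 v -> L2 w -> weak_pair v w ->
  smooth P -> smooth Q -> L2 D ->
  (forall x, a <= x -> `|P x| <= D x) -> (forall x, x <= a + 1 -> `|Q x| <= D x) ->
  (forall x, a <= x -> `|derive1 P x| <= D x) ->
  (forall x, x <= a + 1 -> `|derive1 Q x| <= D x) ->
  intg (fun x => w x * piecewise a P Q x) =
  - intg (fun x => v x * piecewise a (derive1 P) (derive1 Q) x) - v a * (P a - Q a).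
Proof.
move=> cv L2v L2w vw sP sQ L2D hP hQ hP' hQ'.
have h := spike_cvg L2v L2w vw sP sQ L2D hP hQ hP' hQ'.
have cf : continuous (fun x => v x * (P x - Q x)).
  move=> x; apply: cvgM; first exact: cv.
  by apply: cvgB; exact: smooth_continuous.
have h' := spike_delta (a := a) cf.
have E n : intg (fun x => v x * (spike a n x * (P x - Q x))) =
           intg (fun x => v x * (P x - Q x) * spike a n x).
  by apply: eq_Rintegral => x _; ring.
rewrite (eq_cvg _ _ E) in h.
by have /= := cvg_unique _ h h'; move=> <-//; ring.
Qed.

Lemma smooth_vanishing_le f a : smooth f -> f a = 0 ->
  exists2 L, 0 <= L & forall x, a <= x <= a + 1 -> `|f x| <= L * (x - a).
Proof.
move=> sf fa0.
have [L L0 hL] := continuous_itv_bounded a (a + 1)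
  (smooth_continuous (smooth_derive1 sf)).
exists L => // x /andP[ax xa].
have [c|c /[!in_itv]/= /andP[ac cx]] := @MVT_segment _ f (derive1 f) a x ax
  (fun y _ => smooth_is_derive y sf).
  exact/continuous_subspaceT/smooth_continuous.
rewrite fa0 subr0 => ->; rewrite normrM (@ger0_norm _ (x - a)) ?subr_ge0//.
by rewrite ler_wpM2r ?subr_ge0// hL// ac (le_trans cx).
Qed.

(** When v is merely square-integrable, the values of v near a are not controlled,
    but the absence of a jump makes P - Q of order 1/n on the support of the
    spike, which compensates for its height. *)
Lemma by_parts_continuous a P Q D v w :
  L2 v -> L2 w -> weak_pair v w ->
  smooth P -> smooth Q -> L2 D -> P a = Q a ->
  (forall x, a <= x -> `|P x| <= D x) -> (forall x, x <= a + 1 -> `|Q x| <= D x) ->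
  (forall x, a <= x -> `|derive1 P x| <= D x) ->
  (forall x, x <= a + 1 -> `|derive1 Q x| <= D x) ->
  intg (fun x => w x * piecewise a P Q x) =
  - intg (fun x => v x * piecewise a (derive1 P) (derive1 Q) x).
Proof.
move=> L2v L2w vw sP sQ L2D PQ hP hQ hP' hQ'.
have h := spike_cvg L2v L2w vw sP sQ L2D hP hQ hP' hQ'.
suff h0 : intg (fun x => v x * (spike a n x * (P x - Q x))) @[n --> \oo] --> (0 : R).
  by apply/eqP; rewrite -addr_eq0 -oppr_eq0; apply/eqP; exact: (cvg_unique _ h h0).
have <- : intg (fun=> (0 : R)) = 0 by rewrite /Rintegral integral0.
have [M M0 hM] := spike_le a.
have [|L L0 hL] := @smooth_vanishing_le (fun x => P x - Q x) a (smoothB sP sQ).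
  by rewrite PQ subrr.
have L2pl : L2 (fun x => M * L * plateau (x - a)).
  apply: L2_scale; apply: (@L2_vanish _ _ (`|a| + 2)).
    apply: smooth_continuous; under eq_fun do rewrite -[X in X - _]mul1r.
    exact: smooth_affine smooth_plateau.
  move=> x hx; apply: plateau_vanishes.
  by have := lerB_dist x a; lra.
have mv : measurable_fun setT v by case: L2v.
apply: (@dominated_intg _ _ _ (fun x => `|v x| * (M * L * plateau (x - a)))).
- move=> n; apply: measurable_funM => //.
  apply: smooth_measurable; apply: (smoothM _ (smoothB sP sQ)).
  exact: smooth_spike.
- move=> x; have [xa|ax|->] := ltgtP x a.
  + apply: cvg_near_cst; near=> n; rewrite spike_out ?mul0r ?mulr0//.
    by rewrite (leNgt a) xa.
  + apply: cvg_near_cst; near=> n; rewrite spike_out ?mul0r ?mulr0//.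
    rewrite (ltW ax)/= -ltNge -ltrBrDl.
    have xa0 : 0 < x - a by rewrite subr_gt0.
    rewrite invf_plt ?posrE//.
    apply: (@lt_le_trans _ _ ((x - a)^-1 + 1)); first by rewrite ltrDl.
    by near: n; exact: near_large_nat.
  + by apply: cvg_near_cst; near=> n; rewrite PQ subrr !mulr0.
- by apply: integrable_L2M => //; exact: L2_abs.
- move=> n x; rewrite normrM ler_wpM2l//.
  have n0 : 0 < n.+1%:R :> R by rewrite ltr0n.
  have pl0 : 0 <= plateau (x - a) by apply: mulr_ge0; exact: step_ge0.
  have [/andP[ax xa]|/spike_out ->] := boolP (a <= x <= a + n.+1%:R^-1); last first.
    by rewrite mul0r normr0 mulr_ge0// mulr_ge0.
  have n1 : n.+1%:R^-1 <= 1 :> R by rewrite invf_le1 ?ler1n.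
  have xa1 : x <= a + 1 by rewrite (le_trans xa)// lerD2l.
  rewrite plateau1 ?mulr1; last by rewrite ger0_norm ?subr_ge0// lerBlDl.
  apply: (@le_trans _ _ ((n.+1%:R * M) * (L * n.+1%:R^-1))).
    rewrite normrM ler_pM// (le_trans (hL x _)) ?ax// ler_wpM2l// lerBlDl.
    exact: xa.
  have kk (k : R) : 0 < k -> k * M * (L * k^-1) = M * L by move=> k0; field; rewrite gt_eqF.
  by rewrite kk.
Unshelve. all: by end_near. Qed.

End ByParts.

(** * Trigonometric sums and the profile of the kernel *)

Section Trig.
Context {R : realType}.
Implicit Types (x y th psi : R) (n m k l s : nat).

Lemma sinDnpi x m : sin (x + m%:R * pi) = (-1) ^+ m * sin x.
Proof. by rewrite mulr_natl (alternatingn (@sinDpi R)). Qed.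

Lemma cosDnpi x m : cos (x + m%:R * pi) = (-1) ^+ m * cos x.
Proof. by rewrite mulr_natl (alternatingn (@cosDpi R)). Qed.

Lemma sin_cos_telescope psi th k :
  2 * sin th * cos (psi + 2 * k%:R * th) =
  sin (psi + 2 * k.+1%:R * th - th) - sin (psi + 2 * k%:R * th - th).
Proof.
rewrite -[k.+1%:R]natr1 (_ : psi + 2 * (k%:R + 1) * th - th = psi + 2 * k%:R * th + th); last by ring.
by rewrite sinD sinB; ring.
Qed.

(** The sum telescopes after multiplication by 2 sin th. *)
Lemma sum_cos_arith psi th n m : sin th != 0 -> n%:R * th = m%:R * pi ->
  \sum_(0 <= k < n) cos (psi + 2 * k%:R * th) = 0.
Proof.
move=> sth nth; apply: (@mulfI _ (2 * sin th)); first by rewrite mulf_neq0// pnatr_eq0.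
rewrite mulr0 mulr_sumr.
under eq_bigr do rewrite sin_cos_telescope.
rewrite (telescope_sumr (fun k => sin (psi + 2 * k%:R * th - th)))//.
rewrite -mulrA nth mulr0 mul0r addr0.
have -> : psi + 2 * (m%:R * pi) - th = (psi - th + m%:R * pi) + m%:R * pi by ring.
by rewrite !sinDnpi mulrA -exprD addnn -mul2n exprM sqrrN !expr1n mul1r subrr.
Qed.

Definition theta s j : R := j%:R * pi / s.+1%:R.

Lemma theta_mul s j : s.+1%:R * theta s j = j%:R * pi.
Proof. by rewrite /theta mulrC divfK// pnatr_eq0. Qed.

(** Exchanges the roles of the index of summation and of the frequency, so that
    sums over the angles become arithmetic progressions as well. *)
Lemma theta_swap s j l : j%:R * theta s l = l%:R * theta s j.
Proof. by rewrite /theta; ring. Qed.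

Lemma sin_theta_gt0 s j : (0 < j <= s)%N -> 0 < sin (theta s j).
Proof.
move=> /andP[j0 js]; apply: sin_gt0_pi; rewrite /theta divr_gt0 ?mulr_gt0 ?ltr0n ?pi_gt0//=.
by rewrite ltr_pdivrMr ?ltr0n// mulrC ltr_pM2l ?pi_gt0// ltr_nat ltnS.
Qed.

Lemma sum_cos_theta s l : (0 < l <= s)%N ->
  \sum_(0 <= j < s.+1) cos (2 * l%:R * theta s j) = 0.
Proof.
move=> ls; rewrite -[RHS](@sum_cos_arith 0 (theta s l) s.+1 l).
- by apply: eq_bigr => j _; rewrite add0r -!mulrA theta_swap.
- by rewrite gt_eqF ?sin_theta_gt0.
- exact: theta_mul.
Qed.

Lemma sum_cos_theta_last s :
  \sum_(0 <= j < s.+1) cos (2 * s.+1%:R * theta s j) = s.+1%:R :> R.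
Proof.
under eq_bigr => j _.
  rewrite -mulrA theta_mul (_ : 2 * (j%:R * pi) = 0 + j%:R * pi + j%:R * pi); last by ring.
  rewrite !cosDnpi mulrA -exprD addnn -mul2n exprM sqrrN !expr1n mul1r cos0.
  over.
by rewrite big_const_nat subn0 iter_addr addr0.
Qed.

(** Product-to-sum formula; the term j = 0 of the left-hand side vanishes, which
    allows starting the cosine sums at 0. *)
Lemma sum_sin_sin_theta s l :
  2 * \sum_(1 <= j < s.+1) (sin (theta s j) * sin ((2 * l%:R + 1) * theta s j)) =
  \sum_(0 <= j < s.+1) cos (2 * l%:R * theta s j) -
  \sum_(0 <= j < s.+1) cos (2 * l.+1%:R * theta s j).
Proof.
have -> : \sum_(1 <= j < s.+1) (sin (theta s j) * sin ((2 * l%:R + 1) * theta s j)) =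
          \sum_(0 <= j < s.+1) (sin (theta s j) * sin ((2 * l%:R + 1) * theta s j)).
  have th0 : theta s 0 = 0 by rewrite /theta !mul0r.
  by rewrite [RHS]big_nat_recl//= th0 sin0 mul0r add0r big_add1.
rewrite mulr_sumr -sumrB; apply: eq_bigr => j _.
move: (theta s j) => th.
rewrite (_ : 2 * l%:R * th = (2 * l%:R + 1) * th - th); last by ring.
rewrite (_ : 2 * l.+1%:R * th = (2 * l%:R + 1) * th + th); last by rewrite -[l.+1%:R]natr1; ring.
by rewrite cosB cosD; ring.
Qed.

(** The real part of exp(i (2 th + y e^(i th))) differentiated k times: since
    i e^(i th) = e^(i (th + pi/2)), each derivative adds th + pi/2 to the phase. *)
Definition wave th k y : R :=
  expR (- (y * sin th)) * cos (y * cos th + 2 * th + k%:R * (th + pi / 2)).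

Lemma is_derive_wave th k y :
  is_derive (y : R) (1 : R) (wave th k) (wave th k.+1 y).
Proof.
have d1 : is_derive (y : R) (1 : R) (fun y => - (y * sin th)) (- sin th).
  have := is_derive1M (is_derive_id y (1:R)) (is_derive_cst (- sin th) y (1:R)).
  rewrite /cst mulr0 addr0 mul1r.
  by under eq_fun do rewrite mulrN.
pose ph : R := 2 * th + k%:R * (th + pi / 2).
have d2 : is_derive (y : R) (1 : R) (fun y => y * cos th + ph) (cos th).
  have := is_derive1D (is_derive1M (is_derive_id y (1:R)) (is_derive_cst (cos th) y (1:R)))
    (is_derive_cst ph y (1:R)).
  by rewrite /cst mulr0 !addr0 mul1r.
have de := is_derive1_comp (f := expR) (g := fun y => - (y * sin th)) (is_derive_expR _) d1.
have dc := is_derive1_comp (f := cos) (g := fun y => y * cos th + ph) (is_derive_cos _) d2.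
have := is_derive1M de dc => h.
have {h} : is_derive (y : R) (1 : R) (wave th k)
   (expR (- (y * sin th)) * - sin th * cos (y * cos th + ph) +
    expR (- (y * sin th)) * (- sin (y * cos th + ph) * cos th)).
  rewrite (_ : wave th k = fun y => expR (- (y * sin th)) * cos (y * cos th + ph))//.
  by apply/funext => z; rewrite /wave /ph addrA.
move=> h; apply: (is_derive_eq h).
rewrite /wave (_ : y * cos th + 2 * th + k.+1%:R * (th + pi / 2) =
  y * cos th + ph + th + pi / 2); last by rewrite /ph -[k.+1%:R]natr1; ring.
by move: (y * cos th + ph) => A; rewrite cosDpihalf sinD; ring.
Qed.

(** The half-turns in the phase absorb the signs (-1)^k, leaving the cosines of an
    arithmetic progression of difference 2 th whose s + 1 terms cover whole turns. *)
Lemma wave_ode s j y : (0 < j <= s)%N ->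
  \sum_(0 <= k < s.+1) (-1) ^+ k * wave (theta s j) k.*2 y = 0.
Proof.
move=> js; set th := theta s j.
transitivity (expR (- (y * sin th)) *
    \sum_(0 <= k < s.+1) cos (y * cos th + 2 * th + 2 * k%:R * th)).
  rewrite mulr_sumr; apply: eq_bigr => k _; rewrite /wave -mul2n natrM.
  rewrite (_ : _ + _ * (th + pi / 2) = y * cos th + 2 * th + 2 * k%:R * th + k%:R * pi); last by field.
  rewrite cosDnpi mulrCA; congr (_ * _); rewrite mulrA -exprD addnn -mul2n exprM sqrrN.
  by rewrite !expr1n mul1r.
rewrite (@sum_cos_arith _ _ _ j) ?mulr0 ?theta_mul//.
by rewrite gt_eqF// sin_theta_gt0.
Qed.

Lemma wave_odd0 th l : wave th l.*2.+1 0 = (-1) ^+ l.+1 * sin ((2 * l.+1%:R + 1) * th).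
Proof.
rewrite /wave mul0r oppr0 expR0 mul1r mul0r add0r.
rewrite -[l.*2.+1]addn1 -mul2n natrD natrM.
rewrite (_ : _ + _ = ((2 * l.+1%:R + 1) * th - pi / 2) + l.+1%:R * pi); last first.
  by rewrite -[l.+1%:R]natr1; field.
by rewrite cosDnpi cosBpihalf.
Qed.

(** The k-th derivative of the kernel at distance y to the right of its centre. *)
Definition profile s k y : R :=
  - \sum_(1 <= j < s.+1) (sin (theta s j) / s.+1%:R * wave (theta s j) k y).

Lemma is_derive1_sum (I : Type) (r : seq I) (F dF : I -> R -> R) y :
  (forall i, is_derive (y : R) (1 : R) (F i) (dF i y)) ->
  is_derive (y : R) (1 : R) (fun y => \sum_(i <- r) F i y) (\sum_(i <- r) dF i y).
Proof.
move=> h; elim: r => [|i r IH].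
  under eq_fun do rewrite big_nil; rewrite big_nil; exact: is_derive_cst.
by under eq_fun do rewrite big_cons; rewrite big_cons; exact: is_derive1D.
Qed.

Lemma is_derive_profile s k y :
  is_derive (y : R) (1 : R) (profile s k) (profile s k.+1 y).
Proof.
apply: is_deriveN.
apply: (@is_derive1_sum _ _ _ (fun j y => sin (theta s j) / s.+1%:R * wave (theta s j) k.+1 y)).
move=> j; set c := sin _ / _.
have := is_derive1M (is_derive_cst c y (1:R)) (is_derive_wave (theta s j) k y).
by rewrite /cst mul0r add0r.
Qed.

Lemma smooth_profile s k : smooth (profile s k).
Proof.
apply: (@smooth_coind _ [set f | exists k, f = profile s k]); last by exists k.
move=> _ [m ->]; exists (profile s m.+1); first by exists m.+1.
by move=> x; exact: is_derive_profile.
Qed.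

Lemma profile_ode s y : \sum_(0 <= k < s.+1) (-1) ^+ k * profile s k.*2 y = 0.
Proof.
rewrite /profile; under eq_bigr do rewrite mulrN mulr_sumr.
rewrite sumrN exchange_big/= big_nat_cond big1 ?oppr0// => j /andP[js _].
under eq_bigr do rewrite mulrCA.
by rewrite -mulr_sumr wave_ode ?mulr0.
Qed.

(** By [sum_sin_sin_theta] the value is a difference of two cosine sums.  Both are
    0 unless l + 1 = s, when the second consists of s + 1 ones. *)
Lemma profile_odd0 s l : (l.+1 <= s)%N ->
  profile s l.*2.+1 0 = if l.+1 == s then (-1) ^+ s / 2 else 0.
Proof.
move=> ls; rewrite /profile.
under eq_bigr do rewrite wave_odd0.
set X := \sum_(_ <= _ < _) _.
have XE : X = (-1) ^+ l.+1 / s.+1%:R / 2 * (2 *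
   \sum_(1 <= j < s.+1) (sin (theta s j) * sin ((2 * l.+1%:R + 1) * theta s j))).
  rewrite mulrA -[_ / 2 * 2]mulrA mulVf ?pnatr_eq0// mulr1 mulr_sumr.
  by apply: eq_bigr => j _; ring.
rewrite XE sum_sin_sin_theta (@sum_cos_theta _ l.+1)// sub0r.
case: eqVneq => [E|ne]; last by rewrite sum_cos_theta ?oppr0 ?mulr0 ?oppr0//= ltn_neqAle ne.
rewrite -E in X XE *; rewrite sum_cos_theta_last.
have : l.+2%:R != 0 :> R by rewrite pnatr_eq0.
by move: (l.+2%:R) => N N0; field.
Qed.

End Trig.

(** * The kernel, its derivatives and the reproducing identity *)

Section Kernel.
Context {R : realType}.
Implicit Types (x y a : R) (k l s : nat) (f g phi : R -> R).

(** The primitive is the arctangent. *)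
Lemma integrable_oneDsqrV : L1 (fun x => (oneDsqr x)^-1).
Proof.
have m : measurable_fun setT (fun x : R => (oneDsqr x)^-1).
  by apply: continuous_measurable_fun; exact: continuous_oneDsqrV.
apply/integrableP; split; first exact/measurable_EFinP.
have p x : 0 <= (oneDsqr x)^-1 by rewrite invr_ge0 (le_trans ler01)// oneDsqr_ge1.
under eq_integral do rewrite /= ger0_norm//.
rewrite ge0_symfun_integralT//; last 2 first.
- exact: continuous_oneDsqrV.
- by move=> x /=; rewrite /oneDsqr sqrrN.
by rewrite -set_itvcy integral0y_oneDsqr -EFinM ltry.
Qed.

Lemma L2D f g : L2 f -> L2 g -> L2 (fun x => f x + g x).
Proof.
move=> hf hg; have mf : measurable_fun setT f by case: hf.
have mg : measurable_fun setT g by case: hg.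
apply: L2P; first exact: measurable_funD.
apply: (@integrable_dominated _ _ (fun x => 2 * f x ^+ 2 + 2 * g x ^+ 2)).
- by apply: measurable_funX; exact: measurable_funD.
- move=> x; rewrite ger0_norm ?sqr_ge0//.
  by have := sqr_ge0 (f x - g x); nra.
- by apply: integrable_add; apply: integrable_scale; exact: integrable_sqr.
Qed.

Lemma L2_sum (I : eqType) (r : seq I) (F : I -> R -> R) :
  (forall i, i \in r -> L2 (F i)) -> L2 (fun x => \sum_(i <- r) F i x).
Proof.
elim: r => [|i r IH] h.
  under eq_fun do rewrite big_nil; apply: L2P => //.
  by under eq_fun do rewrite expr0n; exact: integrable0.
under eq_fun do rewrite big_cons; apply: L2D; first by apply: h; rewrite mem_head.
by apply: IH => j jr; apply: h; rewrite inE jr orbT.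
Qed.

(** Its square is bounded by a multiple of 1/(1 + x^2), from exp t >= 1 + t^2/2. *)
Lemma L2_exp_decay c a : 0 < c -> L2 (fun x => expR (- (c * `|x - a|))).
Proof.
move=> c0.
have cf : continuous (fun x => expR (- (c * `|x - a|))).
  move=> x; apply: continuous_comp; last exact: continuous_expR.
  apply: cvgN; apply: cvgM; first exact: cvg_cst.
  by apply: cvg_norm; apply: cvgB; [exact: cvg_id|exact: cvg_cst].
apply: L2P; first exact: continuous_measurable_fun.
(* With t = 2 c |x - a|, this constant gives 1 + x^2 <= C (1 + t^2/2), because
   x^2 <= 2 (x - a)^2 + 2 a^2. *)
pose C := 1 + 2 * a ^+ 2 + (c ^+ 2)^-1.
apply: (@integrable_dominated _ _ (fun x => C * (oneDsqr x)^-1)); last first.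
- exact/integrable_scale/integrable_oneDsqrV.
- move=> x; rewrite ger0_norm ?sqr_ge0// -expRM_natl mulrN expRN.
  have q0 : 0 < oneDsqr x by rewrite (lt_le_trans ltr01)// oneDsqr_ge1.
  set t := 2 * _; have t0 : 0 <= t by rewrite !mulr_ge0// ltW.
  rewrite ler_pdivlMr// mulrC ler_pdivrMr ?expR_gt0//.
  apply: (@le_trans _ _ (C * (1 + t ^+ 2 / 2))); last first.
    rewrite ler_wpM2l//; last exact: (expR_ge1Dxn 1).
    apply: addr_ge0; last by rewrite invr_ge0; exact: sqr_ge0.
    by apply: addr_ge0 => //; apply: mulr_ge0 => //; exact: sqr_ge0.
  have -> : t ^+ 2 / 2 = 2 * c ^+ 2 * (x - a) ^+ 2.
    by rewrite /t !exprMn real_normK ?num_real//; field.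
  have c2 : 0 < c ^+ 2 by rewrite exprn_gt0.
  have -> : C * (1 + 2 * c ^+ 2 * (x - a) ^+ 2) =
    1 + 2 * a ^+ 2 + (c ^+ 2)^-1 + (1 + 2 * a ^+ 2) * (2 * c ^+ 2 * (x - a) ^+ 2)
      + 2 * (x - a) ^+ 2.
    by rewrite /C; field; rewrite gt_eqF.
  rewrite /oneDsqr.
  have h1 : 0 <= (1 + 2 * a ^+ 2) * (2 * c ^+ 2 * (x - a) ^+ 2).
    apply: mulr_ge0; first by apply: addr_ge0 => //; apply: mulr_ge0 => //; exact: sqr_ge0.
    by apply: mulr_ge0; [apply: mulr_ge0 => //; exact: ltW|exact: sqr_ge0].
  have h2 : 0 < (c ^+ 2)^-1 by rewrite invr_gt0.
  move: h1 h2; move: (_ * _) (_^-1) => A B h1 h2.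
  by have := sqr_ge0 (x - 2 * a); nra.
- apply: measurable_funX; exact: continuous_measurable_fun.
Qed.

(** A square-integrable bound for all derivatives of the kernel.  The factor
    exp 2 leaves room for the left branch to be evaluated up to distance 1 beyond
    the centre, as the interpolation requires. *)
Definition envelope s y : R :=
  \sum_(1 <= j < s.+1) expR 2 * expR (- (sin (theta s j) * `|y|)).

Lemma wave_le th k y : 0 <= sin th -> - 1 <= y ->
  `|wave th k y| <= expR 2 * expR (- (sin th * `|y|)).
Proof.
move=> S0 y1; rewrite /wave normrM (ger0_norm (expR_ge0 _)).
rewrite -[leRHS]mulr1 ler_pM ?expR_ge0 ?cos_max// -expRD ler_expR.
have S1 := sin_le1 th.
have [y0|y0] := leP 0 y; first by rewrite ger0_norm//; nra.
by rewrite ltr0_norm//; nra.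
Qed.

Lemma profile_le s k y : - 1 <= y -> `|profile s k y| <= envelope s y.
Proof.
move=> y1; rewrite /profile normrN (le_trans (ler_norm_sum _ _ _))//.
rewrite /envelope !big_nat; apply: ler_sum => j js.
have S0 : 0 < sin (theta s j) :> R by exact: sin_theta_gt0.
rewrite normrM -[leRHS]mul1r ler_pM//; last exact: wave_le (ltW S0) y1.
rewrite ger0_norm; last by rewrite divr_ge0// ltW.
rewrite ler_pdivrMr ?ltr0n// mul1r (le_trans (sin_le1 _))//.
by rewrite ler1n.
Qed.

Lemma L2_envelope s a : L2 (fun x => envelope s (x - a)).
Proof.
apply: L2_sum => j; rewrite mem_index_iota => js.
by apply: L2_scale; apply: L2_exp_decay; exact: sin_theta_gt0.
Qed.

Definition kernelR s a k x : R := profile s k (x - a).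
Definition kernelL s a k x : R := (-1) ^+ k * profile s k (a - x).
(** The k-th classical derivative of the kernel centred at a; its value at a itself,
    where it may jump, is taken from the left branch. *)
Definition kernelD s a k : R -> R := piecewise a (kernelR s a k) (kernelL s a k).

Lemma is_derive_kernelR s a k x :
  is_derive (x : R) (1 : R) (kernelR s a k) (kernelR s a k.+1 x).
Proof.
have h : is_derive (x : R) (1 : R) (fun x => x - a) 1.
  apply: (is_derive_eq
    (is_derive1D (is_derive_id x (1 : R)) (is_derive_cst (- a) x (1:R)))).
  by rewrite addr0.
have := is_derive1_comp (f := profile s k) (g := fun x => x - a) (is_derive_profile s k _) h.
by rewrite mulr1.
Qed.

Lemma is_derive_kernelL s a k x :
  is_derive (x : R) (1 : R) (kernelL s a k) (kernelL s a k.+1 x).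
Proof.
have h : is_derive (x : R) (1 : R) (fun x => a - x) (- 1).
  apply: (is_derive_eq
    (is_derive1D (is_derive_cst a x (1:R)) (is_deriveN (is_derive_id x (1 : R))))).
  by rewrite add0r.
have h1 := is_derive1_comp (f := profile s k) (g := fun x => a - x) (is_derive_profile s k _) h.
apply: (is_derive_eq (is_derive1M (is_derive_cst ((-1) ^+ k : R) x (1:R)) h1)).
by rewrite /kernelL /= mul0r add0r exprS; ring.
Qed.

Lemma derive1_kernelR s a k : derive1 (kernelR s a k) = kernelR s a k.+1.
Proof. apply: is_derive1_fun => x; exact: is_derive_kernelR. Qed.

Lemma derive1_kernelL s a k : derive1 (kernelL s a k) = kernelL s a k.+1.
Proof. apply: is_derive1_fun => x; exact: is_derive_kernelL. Qed.

Lemma smooth_kernelR s a k : smooth (kernelR s a k).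
Proof.
apply: (@smooth_coind _ [set f | exists k, f = kernelR s a k]); last by exists k.
move=> _ [m ->]; exists (kernelR s a m.+1); first by exists m.+1.
by move=> x; exact: is_derive_kernelR.
Qed.

Lemma smooth_kernelL s a k : smooth (kernelL s a k).
Proof.
apply: (@smooth_coind _ [set f | exists k, f = kernelL s a k]); last by exists k.
move=> _ [m ->]; exists (kernelL s a m.+1); first by exists m.+1.
by move=> x; exact: is_derive_kernelL.
Qed.

Lemma kernelR_le s a k x : a <= x -> `|kernelR s a k x| <= envelope s (x - a).
Proof. by move=> ax; apply: profile_le; lra. Qed.

Lemma kernelL_le s a k x : x <= a + 1 -> `|kernelL s a k x| <= envelope s (x - a).
Proof.
move=> ax; rewrite /kernelL normrM normrX normrN1 expr1n mul1r.
rewrite (le_trans (profile_le _ _ _)) ?lerBrDl; first by [].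
  by rewrite lerBlDr.
by rewrite /envelope distrC.
Qed.

Lemma L2_kernelD s a k : L2 (kernelD s a k).
Proof.
apply: (@L2_piecewise _ a _ _ (fun x => envelope s (x - a))).
- exact: smooth_kernelR.
- exact: smooth_kernelL.
- exact: L2_envelope.
- exact: kernelR_le.
- exact: kernelL_le.
Qed.

(** Even derivatives agree on both sides by symmetry; odd ones jump by twice the
    value of the profile at 0. *)
Lemma kernel_jump s a k : (0 < s)%N -> (k < s.*2)%N ->
  kernelR s a k a - kernelL s a k a = if k == s.*2.-1 then (-1) ^+ s else 0.
Proof.
move=> s0 ks; rewrite /kernelR /kernelL subrr.
have [ko|ke] := boolP (odd k); last first.
  rewrite -signr_odd (negbTE ke) expr0 mul1r subrr.
  case: eqP => // E; move: ke; rewrite E.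
  by case: s s0 {ks E} => // s' _; rewrite doubleS /= odd_double.
have kE : k = k./2.*2.+1 by rewrite -[LHS]odd_double_half ko.
rewrite -signr_odd ko expr1 mulN1r opprK.
have ls : (k./2.+1 <= s)%N by rewrite -leq_double doubleS -kE; lia.
rewrite kE profile_odd0//.
have -> : (k./2.*2.+1 == s.*2.-1) = (k./2.+1 == s).
  by apply/eqP/eqP; lia.
case: ifP => _; last by rewrite addr0.
by rewrite -splitr.
Qed.

Lemma by_parts_kernel s a k v w : (0 < s)%N -> (k.+1 < s.*2)%N ->
  L2 v -> L2 w -> weak_pair v w ->
  intg (fun x => w x * kernelD s a k x) = - intg (fun x => v x * kernelD s a k.+1 x).
Proof.
move=> s0 ks L2v L2w vw.
rewrite /kernelD (@by_parts_continuous _ a (kernelR s a k) (kernelL s a k)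
  (fun x => envelope s (x - a)) v w)//.
- by rewrite derive1_kernelR derive1_kernelL.
- exact: smooth_kernelR.
- exact: smooth_kernelL.
- exact: L2_envelope.
- apply/eqP; rewrite -subr_eq0 kernel_jump//; last by lia.
  by rewrite (_ : (k == _) = false)//; apply/eqP; lia.
- exact: kernelR_le.
- exact: kernelL_le.
- rewrite derive1_kernelR; exact: kernelR_le.
- rewrite derive1_kernelL; exact: kernelL_le.
Qed.

Lemma by_parts_kernel_jump s a k v w : (0 < s)%N -> (k < s.*2)%N -> continuous v ->
  L2 v -> L2 w -> weak_pair v w ->
  intg (fun x => w x * kernelD s a k x) = - intg (fun x => v x * kernelD s a k.+1 x)
    - v a * (if k == s.*2.-1 then (-1) ^+ s else 0).
Proof.
move=> s0 ks cv L2v L2w vw.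
rewrite /kernelD (@by_parts_jump _ a (kernelR s a k) (kernelL s a k)
  (fun x => envelope s (x - a)) v w)//.
- by rewrite derive1_kernelR derive1_kernelL kernel_jump.
- exact: smooth_kernelR.
- exact: smooth_kernelL.
- exact: L2_envelope.
- exact: kernelR_le.
- exact: kernelL_le.
- rewrite derive1_kernelR; exact: kernelR_le.
- rewrite derive1_kernelL; exact: kernelL_le.
Qed.

Lemma kernelD_ode s a x : \sum_(0 <= k < s.+1) (-1) ^+ k * kernelD s a k.*2 x = 0.
Proof.
rewrite /kernelD /piecewise; have [xa|ax] := leP x a.
  rewrite -[RHS](profile_ode s (a - x)); apply: eq_bigr => k _.
  by rewrite /kernelL -mul2n exprM sqrrN !expr1n mul1r.
by rewrite -[RHS](profile_ode s (x - a)).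
Qed.

Section Green.
Variables (s : nat) (a : R) (v : nat -> R -> R).
Hypotheses (s0 : (0 < s)%N) (cv : continuous (v 0)).
Hypotheses (L2v : forall k, (k <= s)%N -> L2 (v k)).
Hypotheses (wv : forall k, (k < s)%N -> weak_pair (v k) (v k.+1)).

(** The orders of the kernel derivatives met on the way are at most 2k - 2, hence
    no jump occurs. *)
Lemma green_shift i k : (i < k <= s)%N ->
  intg (fun x => v k x * kernelD s a k x) =
  (-1) ^+ i * intg (fun x => v (k - i)%N x * kernelD s a (k + i)%N x).
Proof.
elim: i => [|i IH] /andP[ik ks]; first by rewrite expr0 mul1r subn0 addn0.
rewrite IH ?(ltnW ik)// (@by_parts_kernel _ _ _ (v (k - i.+1)%N)) //.
- by rewrite addnS exprS mulrN mulN1r mulNr.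
- by lia.
- by apply: L2v; lia.
- by apply: L2v; lia.
- have -> : (k - i = (k - i.+1).+1)%N by lia.
  by apply: wv; lia.
Qed.

(** After [green_shift] has brought u^(k) down to u', one more integration by parts
    reaches the continuous function u itself.  Only in this step can the kernel
    derivative, of order 2k - 1, have a jump, and it does for k = s. *)
Lemma green_term k : (k <= s)%N ->
  intg (fun x => v k x * kernelD s a k x) =
  (-1) ^+ k * intg (fun x => v 0%N x * kernelD s a k.*2 x) +
  (if k == s then v 0%N a else 0).
Proof.
case: k => [|k] ks.
  by rewrite expr0 mul1r (ltn_eqF s0) addr0.
rewrite (@green_shift k) ?ltnSn//.
have -> : (k.+1 - k = 1)%N by lia.
have -> : (k.+1 + k = k.*2.+1)%N by lia.
rewrite (@by_parts_kernel_jump _ _ _ (v 0%N)) //.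
- have -> : (k.*2.+1 == s.*2.-1) = (k.+1 == s) by apply/eqP/eqP; lia.
  rewrite doubleS exprS mulrDr mulrN mulN1r mulNr; congr (_ + _).
  case: eqP => [<-|_]; last by rewrite mulr0 oppr0 mulr0.
  have : (-1) ^+ k * (-1) ^+ k = 1 :> R by rewrite -exprD addnn -signr_odd odd_double.
  rewrite exprS; move: ((-1) ^+ k) (v 0%N a) => e u ee.
  by transitivity (u * (e * e)); [ring|rewrite ee mulr1].
- by lia.
- exact: L2v.
- by apply: L2v; lia.
- by apply: wv; lia.
Qed.

(** The integrals of the products with even derivatives of the kernel cancel by
    [kernelD_ode], which leaves the jump term of [green_term]. *)
Lemma green_identity :
  \sum_(0 <= k < s.+1) intg (fun x => v k x * kernelD s a k x) = v 0%N a.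
Proof.
have L20 : L2 (v 0%N) by exact: L2v.
have int_sum (r : seq nat) (c : nat -> R) :
    L1 (fun x => \sum_(k <- r) c k * (v 0%N x * kernelD s a k.*2 x)) /\
    \sum_(k <- r) c k * intg (fun x => v 0%N x * kernelD s a k.*2 x) =
    intg (fun x => \sum_(k <- r) c k * (v 0%N x * kernelD s a k.*2 x)).
  elim: r => [|k r [IHi IH]].
    rewrite big_nil; under eq_fun do rewrite big_nil; split; first exact: integrable0.
    by rewrite /Rintegral integral0.
  have ik := integrable_L2M L20 (L2_kernelD s a k.*2).
  split.
    under eq_fun do rewrite big_cons.
    by apply: integrable_add => //; exact: integrable_scale.
  rewrite big_cons IH -intgZ// -intgD//; last exact: integrable_scale.
  by apply: eq_Rintegral => x _; rewrite big_cons.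
rewrite big_nat_cond.
under eq_bigr => k /andP[/andP[_ ks] _] do rewrite green_term//.
rewrite -big_nat_cond big_split /= (int_sum _ _).2.
rewrite [X in X + _](_ : _ = 0) ?add0r.
  rewrite big_nat_recr//= eqxx big_nat_cond big1 ?add0r// => k /andP[/andP[_ ks] _].
  by rewrite (ltn_eqF ks).
rewrite (_ : (fun x => _) = fun=> 0) ?/Rintegral ?integral0//; apply/funext => x.
under eq_bigr do rewrite mulrCA.
by rewrite -mulr_sumr kernelD_ode mulr0.
Qed.

End Green.

End Kernel.

(** * Uniqueness of real weak derivatives *)

Section WeakDerivatives.
Context {R : realType}.
Implicit Types (x y a : R) (k l s : nat) (f g h phi : R -> R).

Lemma test_bounded phi : test_function phi -> exists2 M, 0 <= M & forall x, `|phi x| <= M.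
Proof.
move=> /test_functionP[sphi [N hN]]; apply: vanish_bounded hN.
exact: smooth_continuous.
Qed.

Lemma integrable_loc_test g phi : locally_integrable setT g -> test_function phi ->
  L1 (fun x => g x * phi x).
Proof.
move=> lg tphi; have [M M0 hM] := test_bounded tphi.
move: (tphi) => /test_functionP[sphi [N hN]].
have mg : measurable_fun setT g by case: lg.
have i1 := integrable_abs_indic (- N) N lg.
apply: (integrable_dominated _ _ (integrable_scale M i1)).
  by apply: measurable_funM => //; exact: smooth_measurable.
move=> x; rewrite normrM mulrCA ler_wpM2l//.
have [xN|Nx] := leP `|x| N.
  by rewrite indicE mem_set ?mulr1 ?hM//= in_itv/= -ler_norml.
by rewrite hN ?normr0 ?mulr_ge0// ltW.
Qed.

Lemma intg_ae f g : measurable_fun setT f -> measurable_fun setT g ->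
  {ae lebesgue_measure, forall x, f x = g x} -> intg f = intg g.
Proof.
move=> mf mg fg; rewrite /Rintegral; congr fine.
apply: ae_eq_integral => //.
- exact/measurable_EFinP.
- exact/measurable_EFinP.
- move: fg; apply: filterS; first exact: (ae_filter_ringOfSetsType (@lebesgue_measure R)).
  by move=> x -> _.
Qed.

Lemma L2_ae f g : measurable_fun setT f ->
  {ae lebesgue_measure, forall x, f x = g x} -> L2 g -> L2 f.
Proof.
move=> mf fg [mg goo]; split=> //.
rewrite (_ : (\int[_]_x _)%E = (\int[lebesgue_measure]_x (g x ^+ 2)%:E)%E)//.
apply: ae_eq_integral => //.
- by apply/measurable_EFinP; exact: measurable_funX.
- by apply/measurable_EFinP; exact: measurable_funX.
- move: fg; apply: filterS; first exact: (ae_filter_ringOfSetsType (@lebesgue_measure R)).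
  by move=> x -> _.
Qed.

Lemma L2_locally_integrable f : L2 f -> locally_integrable setT f.
Proof.
move=> L2f; have mf : measurable_fun setT f by case: L2f.
split=> //; first exact: openT.
move=> K _ cK; have mK : measurable K by exact: compact_measurable.
have [N [_ hN]] := compact_bounded cK.
pose M := `|N| + 1; have M0 : 0 < M by rewrite ltr_wpDl.
have KM x : K x -> `|x| <= M.
  by move=> Kx; apply: hN Kx; rewrite (le_lt_trans (ler_norm _))// ltrDl.
have L2p : L2 (fun x => plateau (M^-1 * x)).
  apply: (@L2_vanish _ _ (M * 2)).
    apply: smooth_continuous; under eq_fun do rewrite -[_ * _]addr0.
    exact: smooth_affine smooth_plateau.
  move=> x hx; apply: plateau_vanishes.
  by rewrite normrM ger0_norm ?invr_ge0 ?(ltW M0)// mulrC ler_pdivlMr// mulrC.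
have /integrableP[_] : lebesgue_measure.-integrable K
    (EFin \o (fun x => f x * plateau (M^-1 * x))).
  by apply: integrableS (integrable_L2M L2f L2p).
apply: le_lt_trans; rewrite le_eqVlt; apply/orP; left; apply/eqP.
apply: eq_integral => x /set_mem Kx /=.
rewrite plateau1 ?mulr1//.
by rewrite normrM ger0_norm ?invr_ge0 ?(ltW M0)// mulrC ler_pdivrMr// mul1r KM.
Qed.

(** The real and imaginary parts of the complex notion. *)
Definition real_weak_derivative k f g :=
  [/\ locally_integrable setT f, locally_integrable setT g &
    forall phi, test_function phi ->
      intg (fun x => f x * derive1n k phi x) = (-1) ^+ k * intg (fun x => g x * phi x)].

Lemma real_weak_derivative_unique k f g h :
  real_weak_derivative k f g -> real_weak_derivative k f h ->
  {ae lebesgue_measure, forall x, g x = h x}.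
Proof.
move=> [_ lg hg] [_ lh hh].
have := fundamental_lemma (locally_integrableB lg lh).
have z phi : test_function phi -> intg (fun x => (g x - h x) * phi x) = 0.
  move=> tphi; have := hh _ tphi; rewrite hg//.
  move/(@lreg_sign _ _ _ _) => E.
  transitivity (intg (fun x => g x * phi x + - (h x * phi x))).
    by apply: eq_Rintegral => x _; rewrite mulrBl.
  rewrite intgD ?intgN ?E ?subrr//; try exact: integrable_loc_test.
  exact/integrable_opp/integrable_loc_test.
move=> /(_ z); apply: filterS; first exact: (ae_filter_ringOfSetsType (@lebesgue_measure R)).
by move=> x /= /eqP; rewrite subr_eq0 => /eqP.
Qed.

End WeakDerivatives.

(** * The complex Sobolev space *)

Section Complex.
Context {R : realType}.
Implicit Types (x y a : R) (k l s : nat) (u f g : R -> R[i]).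

Lemma ReM_real (z : R[i]) (r : R) : Re (z * r%:C) = Re z * r.
Proof. by case: z => a b /=; rewrite mulr0 subr0. Qed.

Lemma ImM_real (z : R[i]) (r : R) : Im (z * r%:C) = Im z * r.
Proof. by case: z => a b /=; rewrite mulr0 add0r. Qed.

Lemma signM_complex k (z : R[i]) :
  (-1) ^+ k * z = ((-1) ^+ k * Re z) +i* ((-1) ^+ k * Im z).
Proof.
by case: z => a b; rewrite -!(signr_odd _ k); case: (odd k); rewrite /= ?mulN1r ?mul1r.
Qed.

Lemma is_weak_derivativeP k f g : is_weak_derivative k f g <->
  real_weak_derivative k (fun x => Re (f x)) (fun x => Re (g x)) /\
  real_weak_derivative k (fun x => Im (f x)) (fun x => Im (g x)).
Proof.
have E (phi : R -> R) : cintegral (fun x => f x * (derive1n k phi x)%:C) =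
    (-1) ^+ k * cintegral (fun x => g x * (phi x)%:C) <->
    intg (fun x => Re (f x) * derive1n k phi x) = (-1) ^+ k * intg (fun x => Re (g x) * phi x)
    /\ intg (fun x => Im (f x) * derive1n k phi x) = (-1) ^+ k * intg (fun x => Im (g x) * phi x).
  rewrite signM_complex /cintegral /=.
  under eq_Rintegral do rewrite ReM_real.
  under [X in _ +i* X]eq_Rintegral do rewrite ImM_real.
  under [X in ((-1) ^+ k * X) +i* _]eq_Rintegral do rewrite ReM_real.
  under [X in _ +i* ((-1) ^+ k * X)]eq_Rintegral do rewrite ImM_real.
  by split=> [[-> ->]|[-> ->]].
split=> [[[lf1 lf2] [lg1 lg2] h]|[[lf1 lg1 h1] [lf2 lg2 h2]]].
  by split; split=> // phi tphi; have /E[] := h phi tphi.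
by split=> // phi tphi; apply/E; split; [exact: h1|exact: h2].
Qed.

Lemma square_integrableP f : square_integrable f <->
  L2 (fun x => Re (f x)) /\ L2 (fun x => Im (f x)).
Proof.
have E x : Normc.normc (f x) ^+ 2 = Re (f x) ^+ 2 + Im (f x) ^+ 2.
  by case: (f x) => a b /=; rewrite sqr_sqrtr// addr_ge0 ?sqr_ge0.
split=> [[[m1 m2]]|[h1 h2]].
  under eq_integral do rewrite E.
  move=> h; split; split=> //; apply: le_lt_trans h; apply: ge0_le_integral => //.
  - by move=> x _; rewrite lee_fin sqr_ge0.
  - by apply/measurable_EFinP; exact: measurable_funX.
  - by apply/measurable_EFinP; apply: measurable_funD; exact: measurable_funX.
  - by move=> x _; rewrite lee_fin lerDl sqr_ge0.
  - by move=> x _; rewrite lee_fin sqr_ge0.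
  - by apply/measurable_EFinP; exact: measurable_funX.
  - by apply/measurable_EFinP; apply: measurable_funD; exact: measurable_funX.
  - by move=> x _; rewrite lee_fin lerDr sqr_ge0.
split; first by split; [case: h1|case: h2].
under eq_integral do rewrite E.
have := integrable_add (integrable_sqr h1) (integrable_sqr h2).
move=> /integrableP[_]; apply: le_lt_trans; rewrite le_eqVlt; apply/orP; left; apply/eqP.
by apply: eq_integral => x _ /=; rewrite ger0_norm// addr_ge0 ?sqr_ge0.
Qed.

(** Some weak derivative exists, so the chosen representative is one. *)
Lemma weak_derivativeP s u k : sobolev s u -> (0 < k <= s)%N ->
  is_weak_derivative k u (weak_derivative k u).
Proof.
move=> [_ _ hu] ks; case: k ks => // k ks.
by have [g hg _] := hu _ ks; apply: (xgetPex _ (ex_intro _ g hg)).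
Qed.

(** The representative chosen by [weak_derivative] coincides almost everywhere with
    the square-integrable one given by membership in the Sobolev space. *)
Lemma sobolev_weak_derivative s u k : sobolev s u -> (k <= s)%N ->
  (L2 (fun x => Re (weak_derivative k u x)) /\ L2 (fun x => Im (weak_derivative k u x))) /\
  (forall phi : R -> R, test_function phi ->
    intg (fun x => Re (u x) * derive1n k phi x) =
      (-1) ^+ k * intg (fun x => Re (weak_derivative k u x) * phi x) /\
    intg (fun x => Im (u x) * derive1n k phi x) =
      (-1) ^+ k * intg (fun x => Im (weak_derivative k u x) * phi x)).
Proof.
move=> su; case: k => [|k] ks.
  case: su => _ /square_integrableP hu _; split=> // phi _.
  by rewrite expr0 !mul1r.
have hw := weak_derivativeP su (k := k.+1) ks.
have [_ _ hu] := su.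
have [g hg /square_integrableP[g1 g2]] := hu k.+1 ks.
move/is_weak_derivativeP: hg => [hg1 hg2].
move/is_weak_derivativeP: hw => [hw1 hw2].
split; last by move=> phi tphi; case: hw1 => _ _ ->//; case: hw2 => _ _ ->.
split.
- apply: L2_ae g1; last exact: real_weak_derivative_unique hw1 hg1.
  by case: hw1 => _ [].
- apply: L2_ae g2; last exact: real_weak_derivative_unique hw2 hg2.
  by case: hw2 => _ [].
Qed.

(** Both are weak derivatives of u; compare them on phi' and on phi. *)
Lemma sobolev_weak_pair s u k : sobolev s u -> (k < s)%N ->
  weak_pair (fun x => Re (weak_derivative k u x)) (fun x => Re (weak_derivative k.+1 u x)) /\
  weak_pair (fun x => Im (weak_derivative k u x)) (fun x => Im (weak_derivative k.+1 u x)).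
Proof.
move=> su ks.
have [_ h0] := sobolev_weak_derivative su (ltnW ks).
have [_ h1] := sobolev_weak_derivative su ks.
have s1 : (-1) ^+ k.+1 = - (-1) ^+ k :> R by rewrite exprS mulN1r.
split=> phi tphi; have [e0 e0'] := h0 _ (test_function_derive1 tphi);
  have [e1 e1'] := h1 _ tphi.
- by move: e0; rewrite -derive1Sn e1 s1 mulNr -mulrN => /(@lreg_sign _ _ _ _).
- by move: e0'; rewrite -derive1Sn e1' s1 mulNr -mulrN => /(@lreg_sign _ _ _ _).
Qed.

Lemma sobolev_green s u a : (0 < s)%N -> sobolev s u ->
  \sum_(0 <= k < s.+1) intg (fun x => Re (weak_derivative k u x) * kernelD s a k x) = Re (u a) /\
  \sum_(0 <= k < s.+1) intg (fun x => Im (weak_derivative k u x) * kernelD s a k x) = Im (u a).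
Proof.
move=> s0 su; have [[cRe cIm] _ _] := su.
split.
- apply: (@green_identity _ s a (fun k x => Re (weak_derivative k u x))) => //.
    by move=> k ks; have [[]] := sobolev_weak_derivative su ks.
  by move=> k ks; have [] := sobolev_weak_pair su ks.
- apply: (@green_identity _ s a (fun k x => Im (weak_derivative k u x))) => //.
    by move=> k ks; have [[]] := sobolev_weak_derivative su ks.
  by move=> k ks; have [] := sobolev_weak_pair su ks.
Qed.

Definition kernelC s a x : R[i] := (kernelD s a 0 x)%:C.

Lemma kernelD0E s a x : kernelD s a 0 x = profile s 0 `|x - a|.
Proof.
rewrite /kernelD /piecewise /kernelL /kernelR expr0 mul1r.
have [xa|ax] := leP x a.
  by rewrite ler0_norm ?subr_le0// opprB.
by rewrite gtr0_norm// subr_gt0.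
Qed.

(** Induction on k, with the test function in the role of the function that is
    differentiated weakly in [by_parts_kernel]. *)
Lemma kernelD_weak_derivative s a k : (0 < s)%N -> (k < s.*2)%N ->
  real_weak_derivative k (kernelD s a 0) (kernelD s a k).
Proof.
move=> s0 ks; split; [exact/L2_locally_integrable/L2_kernelD|
  exact/L2_locally_integrable/L2_kernelD|].
elim: k ks => [|k IH] ks phi tphi; first by rewrite expr0 mul1r.
have tphi' := test_function_derive1 tphi.
rewrite derive1Sn IH ?(ltnW ks)//.
have E m (f : R -> R) : intg (fun x => kernelD s a m x * f x) =
    intg (fun x => f x * kernelD s a m x).
  by apply: eq_Rintegral => x _; rewrite mulrC.
rewrite E (@by_parts_kernel _ _ _ _ phi)// ?E.
- by rewrite exprS mulN1r mulrN mulNr.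
- exact: L2_test.
- exact: L2_test.
- by move=> f tf; exact: intg_test_by_parts tphi (test_function_smooth tf).
Qed.

Lemma real_weak_derivative0 k : real_weak_derivative k (fun=> 0 : R) (fun=> 0 : R).
Proof.
have l0 : locally_integrable setT (fun=> 0 : R).
  apply: L2_locally_integrable; apply: L2P => //.
  by under eq_fun do rewrite expr0n; exact: integrable0.
split=> // phi _.
have z (f : R -> R) : intg (fun x => 0 * f x) = 0.
  rewrite (_ : (fun x => 0 * f x) = fun=> 0); last by apply/funext => x; rewrite mul0r.
  by rewrite /Rintegral integral0.
by rewrite !z mulr0.
Qed.

Lemma kernelC_weak_derivative s a k : (0 < s)%N -> (k < s.*2)%N ->
  is_weak_derivative k (kernelC s a) (fun x => (kernelD s a k x)%:C).
Proof.
move=> s0 ks; apply/is_weak_derivativeP; split; first exact: kernelD_weak_derivative.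
exact: real_weak_derivative0.
Qed.

Lemma kernelC_square_integrable s a k : square_integrable (fun x => (kernelD s a k x)%:C).
Proof.
apply/square_integrableP; split; first exact: L2_kernelD.
by apply: L2P => //=; under eq_fun do rewrite expr0n; exact: integrable0.
Qed.

Lemma kernelC_sobolev s a : (0 < s)%N -> sobolev s (kernelC s a).
Proof.
move=> s0; split.
- split=> /=; last by move=> x; exact: cvg_cst.
  rewrite (_ : (fun x => _) = (fun x => profile s 0 `|x - a|)); last first.
    by apply/funext => x; rewrite kernelD0E.
  have cp : continuous (@profile R s 0).
    by apply: smooth_continuous; exact: smooth_profile.
  move=> x; apply: (@continuous_comp _ _ _ (fun x => `|x - a|) (profile s 0)); last exact: cp.
  by apply: cvg_norm; apply: cvgB; [exact: cvg_id|exact: cvg_cst].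
- exact: kernelC_square_integrable.
- move=> k /andP[k0 ks]; exists (fun x => (kernelD s a k x)%:C).
    by apply: kernelC_weak_derivative => //; lia.
  exact: kernelC_square_integrable.
Qed.

Lemma kernelC_weak_derivative_ae s a k : (0 < s)%N -> (k <= s)%N ->
  {ae lebesgue_measure, forall x, Re (weak_derivative k (kernelC s a) x) = kernelD s a k x} /\
  {ae lebesgue_measure, forall x, Im (weak_derivative k (kernelC s a) x) = 0}.
Proof.
move=> s0; case: k => [|k] ks; first by split; apply: aeW.
have ks' : (k.+1 < s.*2)%N by lia.
have /is_weak_derivativeP[h1 h2] := weak_derivativeP (kernelC_sobolev a s0) (k := k.+1) ks.
have /is_weak_derivativeP[g1 g2] := kernelC_weak_derivative a s0 ks'.
split; [exact: real_weak_derivative_unique h1 g1|exact: real_weak_derivative_unique h2 g2].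
Qed.

Lemma complex_sum (r : seq nat) (F G : nat -> R) :
  \sum_(i <- r) ((F i) +i* (G i)) = (\sum_(i <- r) F i) +i* (\sum_(i <- r) G i).
Proof.
elim: r => [|i r IH]; first by rewrite !big_nil.
by rewrite !big_cons IH.
Qed.

(** The representatives of the weak derivatives of the kernel are replaced by the
    classical derivatives, and real and imaginary parts are given by
    [sobolev_green]. *)
Lemma sobolev_dot_kernel s a u : (0 < s)%N -> sobolev s u ->
  sobolev_dot s (kernelC s a) u = (u a)^*.
Proof.
move=> s0 su; have [gRe gIm] := sobolev_green a s0 su.
transitivity (Re (u a) +i* - Im (u a)); last by case: (u a).
rewrite -gRe -gIm -sumrN -complex_sum /sobolev_dot !big_nat.
apply: eq_bigr => k /andP[_ ks].
have [aRe aIm] := kernelC_weak_derivative_ae a s0 ks.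
have [[uRe uIm] _] := sobolev_weak_derivative su ks.
have [[GRe GIm] _] := sobolev_weak_derivative (kernelC_sobolev a s0) ks.
have L2k := @L2_kernelD R s a k.
have mk : measurable_fun setT (kernelD s a k) by case: L2k.
case: uRe (uRe) => mRe _ uRe; case: uIm (uIm) => mIm _ uIm.
case: GRe => mGRe _; case: GIm => mGIm _.
rewrite -intgN; last exact: integrable_L2M.
rewrite /cintegral; congr (_ +i* _).
- transitivity (intg (fun x => Re (weak_derivative k (kernelC s a) x) *
    Re (weak_derivative k u x) + Im (weak_derivative k (kernelC s a) x) *
    Im (weak_derivative k u x))).
    apply: eq_Rintegral => x _; case: (weak_derivative k u x) => c d.
    by case: (weak_derivative _ _ x) => c0 d0 /=; ring.
  apply: intg_ae.
  + exact: measurable_funD (measurable_funM mGRe mRe) (measurable_funM mGIm mIm).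
  + exact: measurable_funM mRe mk.
  + move: aRe aIm; apply: filterS2; first exact: (ae_filter_ringOfSetsType (@lebesgue_measure R)).
    by move=> x -> ->; rewrite mul0r addr0 mulrC.
- transitivity (intg (fun x => Im (weak_derivative k (kernelC s a) x) *
    Re (weak_derivative k u x) - Re (weak_derivative k (kernelC s a) x) *
    Im (weak_derivative k u x))).
    apply: eq_Rintegral => x _; case: (weak_derivative k u x) => c d.
    by case: (weak_derivative _ _ x) => c0 d0 /=; ring.
  apply: intg_ae.
  + exact: measurable_funB (measurable_funM mGIm mRe) (measurable_funM mGRe mIm).
  + by apply: measurableT_comp => //; exact: measurable_funM mIm mk.
  + move: aRe aIm; apply: filterS2; first exact: (ae_filter_ringOfSetsType (@lebesgue_measure R)).
    by move=> x -> ->; rewrite mul0r sub0r mulrC.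
Qed.

End Complex.

Theorem mainTheorem2 (R : realType) (s : nat) (hs : (0 < s)%N)
    (K : R -> R -> R[i]) (hK : is_reproducing_kernel s K) (x t : R) :
  K x t =
    (- \sum_(1 <= j < s.+1)
        expR (- (`|x - t| * sin (j%:R * pi / s.+1%:R))) / s.+1%:R
        * sin (j%:R * pi / s.+1%:R)
        * cos (`|x - t| * cos (j%:R * pi / s.+1%:R)
               + 2 * j%:R * pi / s.+1%:R))%:C.
Proof.
have [sK repr] := hK.
have E : K x t = (kernelC s x t)^*.
  by rewrite (repr _ (kernelC_sobolev x hs)) (sobolev_dot_kernel x hs (sK t)) conjcK.
rewrite E /kernelC kernelD0E conjc_real distrC /profile; congr (- _)%:C.
apply: eq_bigr => j _; rewrite /wave /theta mul0r addr0.
rewrite (_ : 2 * j%:R * pi / s.+1%:R = 2 * (j%:R * pi / s.+1%:R)); last by rewrite !mulrA.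
by ring.
Qed.
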